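(* Let $V$ be an infinite-dimensional vector space over a field $\mathbb{F}$. Let $u\in\mathrm{SP}_f(V)$ have determinant $\pm 1$, and let $\varepsilon\in\{-1,1\}$. Then, in the algebra $\mathrm{End}(V)$, $\varepsilon u$ is the product of three involutions, and also of one unipotent element of index $2$ and two involutions, and also of one involution and two unipotent elements of index $2$ (in any prescribed order).
   Context: $\mathrm{End}(V)$ is the algebra of all endomorphisms of $V$. $\mathrm{SP}_f(V)$ is the group of all automorphisms of $V$ of the form $\mathrm{id}_V+w$ with $w$ a finite-rank endomorphism of $V$. For $u\in\mathrm{SP}_f(V)$, the determinant of $u$ is the determinant of the endomorphism $u_{|W}$ of $W$ induced by $u$, where $W$ is any finite-dimensional linear subspace of $V$ that includes $\mathrm{Im}(u-\mathrm{id}_V)$ (this does not depend on the choice of $W$). In a unital algebra, an element $x$ is an involution if $x^2=1$, and is unipotent of index $2$ if $(x-1)^2=0$. *)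

(* Defs.v *)
From HB Require Import structures.
From mathcomp Require Import all_boot all_order all_algebra.
From mathcomp Require Import boolp classical_sets.

Set Implicit Arguments.
Unset Strict Implicit.
Unset Printing Implicit Defensive.

Import GRing.Theory.
Local Open Scope classical_set_scope.
Local Open Scope ring_scope.

(* The algebra End(V), with composition as product. It is only a pzRingType,
   since V may be trivial, whereas MathComp's algType requires 1 != 0; the
   compatibility of scaling with products is endo_scalerAl, endo_scalerAr. *)

Definition endo (F : fieldType) (V : lmodType F) : Type := {linear V -> V}.

Section EndoAlgebra.
Variables (F : fieldType) (V : lmodType F).
Implicit Types f g h : endo V.

Definition endo_fun f : V -> V := f.

Lemma endoP f g : endo_fun f =1 endo_fun g -> f = g.
Proof.
case: f g => [f [[a] [b]]] [g [[c] [d]]] /= /funext.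
rewrite /endo_fun /= => efg; subst g.
by rewrite (Prop_irrelevance a c) (Prop_irrelevance b d).
Qed.

HB.instance Definition _ := gen_eqMixin (endo V).
HB.instance Definition _ := gen_choiceMixin (endo V).

Definition endo_zero : endo V := (\0 : {linear V -> V}).
Definition endo_opp f : endo V := (\- f : {linear V -> V}).
Definition endo_add f g : endo V := (f \+ g : {linear V -> V}).
Definition endo_one : endo V := (idfun : {linear V -> V}).
Definition endo_mul f g : endo V := (f \o g : {linear V -> V}).
Definition endo_scale (a : F) f : endo V := (a \*: f : {linear V -> V}).

Fact endo_addA : associative endo_add.
Proof. by move=> f g h; apply: endoP => v; exact: addrA. Qed.
Fact endo_addC : commutative endo_add.
Proof. by move=> f g; apply: endoP => v; exact: addrC. Qed.
Fact endo_add0 : left_id endo_zero endo_add.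
Proof. by move=> f; apply: endoP => v; exact: add0r. Qed.
Fact endo_addN : left_inverse endo_zero endo_opp endo_add.
Proof. by move=> f; apply: endoP => v; exact: addNr. Qed.

HB.instance Definition _ :=
  GRing.isZmodule.Build (endo V) endo_addA endo_addC endo_add0 endo_addN.

Fact endo_mulA : associative endo_mul.
Proof. by move=> f g h; apply: endoP. Qed.
Fact endo_mul1 : left_id endo_one endo_mul.
Proof. by move=> f; apply: endoP. Qed.
Fact endo_mulr1 : right_id endo_one endo_mul.
Proof. by move=> f; apply: endoP. Qed.
Fact endo_mulDl : left_distributive endo_mul +%R.
Proof. by move=> f g h; apply: endoP. Qed.
Fact endo_mulDr : right_distributive endo_mul +%R.
Proof. by move=> f g h; apply: endoP => v; exact: linearD. Qed.

HB.instance Definition _ := GRing.Zmodule_isPzRing.Build (endo V)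
  endo_mulA endo_mul1 endo_mulr1 endo_mulDl endo_mulDr.

Fact endo_scaleA a b f : endo_scale a (endo_scale b f) = endo_scale (a * b) f.
Proof. by apply: endoP => v; exact: scalerA. Qed.
Fact endo_scale1 : left_id 1 endo_scale.
Proof. by move=> f; apply: endoP => v; exact: scale1r. Qed.
Fact endo_scaleDr : right_distributive endo_scale +%R.
Proof. by move=> a f g; apply: endoP => v; exact: scalerDr. Qed.
Fact endo_scaleDl f : {morph endo_scale^~ f : a b / a + b}.
Proof. by move=> a b; apply: endoP => v; exact: scalerDl. Qed.

HB.instance Definition _ := GRing.Zmodule_isLmodule.Build F (endo V)
  endo_scaleA endo_scale1 endo_scaleDr endo_scaleDl.

Lemma endo_addE f g v : (f + g) v = f v + g v. Proof. by []. Qed.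
Lemma endo_subE f g v : (f - g) v = f v - g v. Proof. by []. Qed.
Lemma endo_oneE v : (1 : endo V) v = v. Proof. by []. Qed.
Lemma endo_mulE f g v : (f * g) v = f (g v). Proof. by []. Qed.
Lemma endo_scaleE (a : F) f v : (a *: f) v = a *: f v. Proof. by []. Qed.

Lemma endo_scalerAl (a : F) f g : a *: (f * g) = (a *: f) * g.
Proof. by apply: endoP. Qed.
Lemma endo_scalerAr (a : F) f g : a *: (f * g) = f * (a *: g).
Proof. by apply: endoP => v; rewrite /endo_fun !(endo_scaleE, endo_mulE) linearZ. Qed.

End EndoAlgebra.

Definition involution (A : pzRingType) (x : A) : Prop := x ^+ 2 = 1.
Definition unipotent2 (A : pzRingType) (x : A) : Prop := (x - 1) ^+ 2 = 0.

Section Dimension.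
Variables (F : fieldType) (V : lmodType F).

Definition lin_span n (e : 'I_n -> V) : set V :=
  [set v | exists c : 'I_n -> F, v = \sum_i c i *: e i].

Definition lin_free n (e : 'I_n -> V) : Prop :=
  forall c : 'I_n -> F, \sum_i c i *: e i = 0 -> forall i, c i = 0.

(* For a linear subspace S, being included in a finitely generated subspace
   amounts to being finite-dimensional. *)
Definition finite_dim (S : set V) : Prop :=
  exists n (e : 'I_n -> V), S `<=` lin_span e.

Definition finite_rank (w : endo V) : Prop := finite_dim (range w).

Definition SPf (u : endo V) : Prop :=
  bijective u /\ exists2 w : endo V, finite_rank w & u = 1 + w.

(* A is the matrix, in some basis e of some finite-dimensional subspace W that
   includes Im(u - id), of the endomorphism of W induced by u. *)
Definition SP_matrix (u : endo V) n (e : 'I_n -> V) (A : 'M[F]_n) : Prop :=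
  [/\ lin_free e, range (u - 1) `<=` lin_span e
    & forall j, u (e j) = \sum_i A i j *: e i].

(* By SP_detE and SP_matrix_exists below, SP_det u is the determinant of all
   such matrices A, and at least one exists when u is in SP_f(V). *)
Definition SP_det (u : endo V) : F :=
  xget 0 [set d | exists n (e : 'I_n -> V) (A : 'M[F]_n),
                    SP_matrix u e A /\ d = \det A].

Let lc n p (e : 'I_n -> V) (M : 'M[F]_(n, p)) (j : 'I_p) : V :=
  \sum_i M i j *: e i.

Let lcM n p q (e : 'I_n -> V) (M : 'M_(n, p)) (N : 'M_(p, q)) j :
  lc (lc e M) N j = lc e (M *m N) j.
Proof.
rewrite /lc; under eq_bigr do rewrite scaler_sumr.
rewrite exchange_big; apply: eq_bigr => i _; rewrite mxE scaler_suml.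
by apply: eq_bigr => k _; rewrite scalerA mulrC.
Qed.

Let eq_lc n p (e f : 'I_n -> V) (M : 'M_(n, p)) j :
  e =1 f -> lc e M j = lc f M j.
Proof. by move=> ef; apply: eq_bigr => i _; rewrite ef. Qed.

Let lc_inj n p (e : 'I_n -> V) (M N : 'M_(n, p)) :
  lin_free e -> lc e M =1 lc e N -> M = N.
Proof.
move=> fe eMN; apply/matrixP => i j; apply/eqP; rewrite -subr_eq0; apply/eqP.
apply: (fe (fun i => M i j - N i j)).
under eq_bigr do rewrite scalerBl.
by rewrite sumrB; apply/eqP; rewrite subr_eq0; apply/eqP/eMN.
Qed.

Let span_lc n p (e : 'I_n -> V) (g : 'I_p -> V) :
  (forall j, lin_span e (g j)) -> exists M : 'M_(n, p), g =1 lc e M.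
Proof.
move=> /choice[c cE]; exists (\matrix_(i, j) c j i) => j.
by rewrite cE; apply: eq_bigr => i _; rewrite mxE.
Qed.

Let free_le n k (e : 'I_n -> V) (g : 'I_k -> V) :
  lin_free g -> (forall i, lin_span e (g i)) -> (k <= n)%N.
Proof.
move=> fg /span_lc[C gC]; rewrite leqNgt; apply/negP => ltnk.
suff : row_free C^T.
  by move=> /eqP rC; have := rank_leq_col C^T; rewrite rC leqNgt ltnk.
rewrite -kermx_eq0; apply/eqP/row_matrixP => i; rewrite row0.
apply: trmx_inj; rewrite trmx0; apply: (lc_inj fg) => j.
rewrite !(eq_lc _ _ gC) !lcM mulmx0; congr (lc e _ j).
have -> : C *m (row i (kermx C^T))^T = (row i (kermx C^T) *m C^T)^T.
  by rewrite trmx_mul trmxK.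
by rewrite -row_mul mulmx_ker row0 trmx0.
Qed.

Let basis_exists (S : set V) : finite_dim S ->
  exists k (g : 'I_k -> V), [/\ lin_free g, forall i, S (g i) & S `<=` lin_span g].
Proof.
case=> n [e Se].
pose P k := `[< exists g : 'I_k -> V, lin_free g /\ forall i, S (g i) >].
have exP : exists k, P k.
  exists 0%N; apply/asboolP; exists (fun _ => 0); split; last by case.
  by move=> c _ [].
have maxP k : P k -> (k <= n)%N.
  by move=> /asboolP[g [fg Sg]]; apply: (@free_le n k e g fg) => i; exact/Se/Sg.
case: (ex_maxnP exP maxP) => k /asboolP[g [fg Sg]] kmax.
exists k, g; split=> // v Sv; apply: contrapT => nv.
suff /kmax : P k.+1 by rewrite ltnn.
apply/asboolP; exists (fun i => if unlift ord0 i is Some j then g j else v).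
split; last by move=> i; case: unliftP => [j|] _.
move=> c; rewrite big_ord_recl unlift_none.
under eq_bigr do rewrite liftK.
move=> c0; have cv : c ord0 = 0.
  apply/eqP; apply/negPn/negP => cn0; apply: nv.
  exists (fun i => - (c ord0)^-1 * c (lift ord0 i)).
  under eq_bigr do rewrite -scalerA.
  move/eqP: c0; rewrite addrC addr_eq0 => /eqP c0.
  by rewrite -scaler_sumr c0 scalerN scaleNr opprK scalerA mulVf ?scale1r.
move: c0; rewrite cv scale0r add0r => /fg cg i.
by case: (unliftP ord0 i) => [j|] ->.
Qed.

Let det_addC m n (C : 'M[F]_(m, n)) (P : 'M_(n, m)) :
  \det (1%:M + C *m P) = \det (1%:M + P *m C).
Proof.
have E1 : block_mx 1%:M (- C) P 1%:M =
    block_mx 1%:M 0 P 1%:M *m block_mx 1%:M (- C) 0 (1%:M + P *m C).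
  rewrite mulmx_block !mul1mx !mul0mx !mulmx1 !addr0 mulmxN.
  by rewrite addrCA addNr addr0.
have E2 : block_mx 1%:M (- C) P 1%:M =
    block_mx 1%:M (- C) 0 1%:M *m block_mx (1%:M + C *m P) 0 P 1%:M.
  rewrite mulmx_block !mul1mx !mul0mx !mulmx1 ?addr0 ?add0r mulNmx.
  by rewrite addrK.
have := congr1 determinant E1.
by rewrite E2 !det_mulmx !(det_ublock, det_lblock) !det1 !mul1r !mulr1.
Qed.

Lemma SP_matrix_uniq (u : endo V) m n (e : 'I_m -> V) (f : 'I_n -> V)
    (A : 'M[F]_m) (B : 'M[F]_n) :
  SP_matrix u e A -> SP_matrix u f B -> \det A = \det B.
Proof.
move=> [fe ie eA] [ff jf fB].
have [|k [g [fg Sg gS]]] := @basis_exists (range (u - 1)); first by exists m, e.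
have key l (h : 'I_l -> V) (M : 'M[F]_l) : lin_free h ->
    range (u - 1) `<=` lin_span h -> (forall j, u (h j) = \sum_i M i j *: h i) ->
    exists2 N : 'M[F]_k, \det M = \det (1%:M + N)
      & forall j, (u - 1) (g j) = lc g N j.
  move=> fh ih hM.
  have [C gC] : exists C : 'M_(l, k), g =1 lc h C.
    by apply: span_lc => j; exact/ih/Sg.
  have [P hP] : exists P : 'M_(k, l), (fun j => (u - 1) (h j)) =1 lc g P.
    by apply: span_lc => j; apply: gS; exists (h j).
  exists (P *m C).
    rewrite -det_addC; congr (\det _); apply: (lc_inj fh) => j.
    rewrite /lc -hM; under eq_bigr do rewrite mxE scalerDl.
    rewrite big_split /= -/(lc h 1%:M j) -/(lc h (C *m P) j) -lcM.
    rewrite -(eq_lc _ _ gC) -hP endo_subE endo_oneE /lc (bigD1 j) //= mxE eqxx.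
    rewrite scale1r big1 => [|i /negPf nij]; last by rewrite mxE nij scale0r.
    by rewrite addr0 addrC subrK.
  move=> j; rewrite -lcM -(eq_lc _ _ hP) gC /lc linear_sum.
  by apply: eq_bigr => i _; rewrite linearZ.
have [N1 -> N1g] := key _ _ _ fe ie eA.
have [N2 -> N2g] := key _ _ _ ff jf fB.
by rewrite (@lc_inj _ _ g N1 N2) // => j; rewrite -N1g -N2g.
Qed.

Lemma SP_detE (u : endo V) n (e : 'I_n -> V) (A : 'M[F]_n) :
  SP_matrix u e A -> SP_det u = \det A.
Proof.
move=> uA; rewrite /SP_det; case: xgetP => [d _ [m [f [B [uB ->]]]]|H].
  exact: SP_matrix_uniq uB uA.
by case: (H (\det A)); exists n, e, A.
Qed.

Lemma SP_matrix_exists (u : endo V) :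
  SPf u -> exists n (e : 'I_n -> V) (A : 'M[F]_n), SP_matrix u e A.
Proof.
case=> _ [w /basis_exists[n [e [fe Se eS]]] uE].
have wE : u - 1 = w by rewrite uE addrC addKr.
have [|A eA] := @span_lc _ _ e (fun j => w (e j)).
  by move=> j; apply: eS; exists (e j).
exists n, e, (1%:M + A); split=> //; first by rewrite wE.
move=> j; under eq_bigr do rewrite mxE scalerDl.
rewrite big_split /= -/(lc e A j) -eA uE endo_addE endo_oneE.
rewrite (bigD1 j) //= mxE eqxx scale1r big1 ?addr0 // => i /negPf nij.
by rewrite mxE nij scale0r.
Qed.

End Dimension.

Definition infinite_dimensional (F : fieldType) (V : lmodType F) : Prop :=
  ~ finite_dim [set: V].

Definition prod3 (A : pzRingType) (P Q R : A -> Prop) (x : A) : Prop :=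
  exists a b c : A, [/\ P a, Q b, R c & x = a * b * c].

(* Main.v *)
From HB Require Import structures.
Require Import Defs.
From mathcomp Require Import all_boot all_order all_algebra.
From mathcomp Require Import boolp classical_sets ring zify.

Import GRing.Theory.
Local Open Scope ring_scope.

(** Let I stand for an involution and U for a unipotent element of index 2.

    The sign [eps] is harmless because the opposite of an involution is an
    involution, and so is the order of the factors, because
    [a b = (a b a^-1) a] and both classes are stable under conjugation.
    It remains to write [u] as products of types III, IUU and UII.

    Write [u = 1 + i Q], where [i] embeds a column space [F^r] into [V] and
    [Q] maps [V] onto [F^r] ([finite_rank_factor]), and let [A = 1 + Q i], an
    [r] by [r] matrix; it is the matrix of [u] on the image of [u - 1], so
    that [det A = det u] ([restriction_matrix]). As [V] is
    infinite-dimensional, there is much freedom in the choice of a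
    finite-dimensional subspace that carries [u]: whenever [P] has a left
    inverse, [Q1] has a right inverse and [Q1 P = A - 1], the operator [u]
    acts as [M = 1 + P Q1] on some copy of [F^N] and as the identity on some
    complement ([realization]). Factorizations of [M] then extend to [u]
    ([transfer]). Call such an [M] a stable form of [A]. The problem becomes:
    if [det A] is 1 or -1, find a stable form of [A] that is a product of type
    III and of type IUU, and one of type UII ([stable_products]).

    The stable forms in use are the block matrices [A Y g | 0 1 0 | 0 0 1]
    with [Y] and [g] at our disposal ([model]). Dividing on the left by a
    suitable involution, or by a suitable unipotent, leaves a matrix of
    companion type [B = 0 s 0 | A zeta g | 0 0 rho] with [s] equal to 1 or -1
    ([model_involution], [model_unipotent]), and [B] must be a product of two
    involutions or of two unipotents. Both are obtained at once when
    [B = (1 + X)(1 + Y)] with [X^2 = Y^2 = 0] and some involution [D]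
    anticommutes with [X] and [Y]: the elements [(1 + X) D] and [D (1 + Y)] are
    then involutions with product [B] ([graded_involution_pair]). Every
    unipotent matrix has this form ([unipotent_graded]).

    If [A] is not scalar, an argument of Sourour gives [- s A = M N] with [N]
    unipotent and [M] unipotent up to a single eigenvalue, which is
    [det (- s A)] ([unipotent_factorization]). With [zeta = M + N] the matrix
    [B] is similar to a block triangular matrix with diagonal blocks [N], [M]
    and [rho] ([companion_triangular]). If the exceptional eigenvalue is 1, it
    is unipotent. If it is -1, it splits off: for UII as a block of size 1,
    which is a product of two involutions ([triangular_involutions]); for III
    and IUU one chooses [rho] so that it comes in a Jordan block of size 2,
    which is a graded pair ([triangular_jordan2]).

    If [A = lam] is scalar, [lam] different from 1 and -1, one takes
    [zeta = - s A C + C^-1 + D] where [C] and [D] commute up to the factor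
    [- s A]; the matrix [B] is then similar to a companion matrix without
    [A] ([twisted_similar]), for which factorizations are explicit. Such [C]
    and [D] are found among weighted cyclic permutations and diagonal matrices
    with geometric entries ([wdiag_wcycle]), corrected by a sign at one place
    when determinants demand it. *)

(** * Corners carrying two kinds of factorizations *)

Section Corner.
Variable R : pzRingType.
Implicit Types e f X Y D B : R.

Definition in_corner e X := e * X = X /\ X * e = X.

(** Inside the corner ring [e R e], [B] is a product of two unipotents of
    index 2, and [D] grades it: [X] and [Y] are odd. Only [B e] is constrained,
    so that several corners can be treated for the same [B]. *)
Definition graded_pair e B := exists X Y D,
  [/\ in_corner e X, in_corner e Y & in_corner e D] /\
  [/\ X * X = 0, Y * Y = 0 & D * D = e] /\
  [/\ D * X = - (X * D), D * Y = - (Y * D) & B * e = (e + X) * (e + Y)].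

Definition involution_pair e B := exists s t,
  [/\ in_corner e s, in_corner e t, s * s = e, t * t = e & B * e = s * t].

Lemma corner_mul0 e f X Y :
  e * f = 0 -> in_corner e X -> in_corner f Y -> X * Y = 0.
Proof. by move=> ef [_ <-] [<- _]; rewrite -mulrA (mulrA e) ef mul0r mulr0. Qed.

Lemma corner_add e f X Y : e * f = 0 -> f * e = 0 ->
  in_corner e X -> in_corner f Y -> in_corner (e + f) (X + Y).
Proof.
move=> ef fe [eX Xe] [fY Yf]; split; rewrite mulrDl !mulrDr.
  have -> : e * Y = 0 by rewrite -fY mulrA ef mul0r.
  have -> : f * X = 0 by rewrite -eX mulrA fe mul0r.
  by rewrite eX fY addr0 add0r.
have -> : Y * e = 0 by rewrite -Yf -mulrA fe mulr0.
have -> : X * f = 0 by rewrite -Xe -mulrA ef mulr0.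
by rewrite Xe Yf addr0 add0r.
Qed.

Lemma corner_addM e f X X' Y Y' : e * f = 0 -> f * e = 0 ->
  in_corner e X -> in_corner f Y -> in_corner e X' -> in_corner f Y' ->
  (X + Y) * (X' + Y') = X * X' + Y * Y'.
Proof.
move=> ef fe cX cY cX' cY'; rewrite mulrDl !mulrDr.
by rewrite (corner_mul0 _ _ _ _ ef cX cY') (corner_mul0 _ _ _ _ fe cY cX') addr0 add0r.
Qed.

Lemma involution_pair_add e f B : e * f = 0 -> f * e = 0 ->
  involution_pair e B -> involution_pair f B -> involution_pair (e + f) B.
Proof.
move=> ef fe [s [t [cs ct ss tt st]]] [s' [t' [cs' ct' ss' tt' st']]].
exists (s + s'), (t + t'); split; try exact: corner_add.
- by rewrite (corner_addM _ _ _ _ _ _ ef fe cs cs' cs cs') ss ss'.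
- by rewrite (corner_addM _ _ _ _ _ _ ef fe ct ct' ct ct') tt tt'.
- by rewrite (corner_addM _ _ _ _ _ _ ef fe cs cs' ct ct') mulrDr st st'.
Qed.

(** Elements of orthogonal corners annihilate each other, so that
    factorizations found on complementary [B]-invariant subspaces add up. *)
Lemma graded_pair_add e f B : e * e = e -> f * f = f ->
  e * f = 0 -> f * e = 0 ->
  graded_pair e B -> graded_pair f B -> graded_pair (e + f) B.
Proof.
move=> ee ff ef fe [X [Y [D [[cX cY cD] [[XX YY DD] [DX DY BE]]]]]].
move=> [X' [Y' [D' [[cX' cY' cD'] [[XX' YY' DD'] [DX' DY' BE']]]]]].
pose M := corner_addM _ _ _ _ _ _ ef fe.
exists (X + X'), (Y + Y'), (D + D'); split; first by split; exact: corner_add.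
split; split.
- by rewrite (M _ _ _ _ cX cX' cX cX') XX XX' addr0.
- by rewrite (M _ _ _ _ cY cY' cY cY') YY YY' addr0.
- by rewrite (M _ _ _ _ cD cD' cD cD') DD DD'.
- by rewrite (M _ _ _ _ cD cD' cX cX') (M _ _ _ _ cX cX' cD cD') DX DX' opprD.
- by rewrite (M _ _ _ _ cD cD' cY cY') (M _ _ _ _ cY cY' cD cD') DY DY' opprD.
have cpl g Z : g * g = g -> in_corner g Z -> in_corner g (g + Z).
  by move=> gg [gZ Zg]; split; rewrite ?mulrDr ?mulrDl gg ?gZ ?Zg.
rewrite mulrDr BE BE' -!(addrACA e X f X') -(addrACA e Y f Y').
by rewrite (M _ _ _ _ (cpl _ _ ee cX) (cpl _ _ ff cX') (cpl _ _ ee cY) (cpl _ _ ff cY')).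
Qed.

(** The factors are [(e + X) D] and [D (e + Y)]: moving [D] across changes the
    sign of [X], and [(e + X)(e - X) = e]. *)
Lemma graded_involution_pair e B : e * e = e ->
  graded_pair e B -> involution_pair e B.
Proof.
move=> ee [X [Y [D [[[eX Xe] [eY Ye] [eD De]] [[XX YY DD] [DX DY BE]]]]]].
exists ((e + X) * D), (D * (e + Y)).
have DXE : D * (e + X) = (e - X) * D by rewrite mulrDr DX De mulrBl eD.
have DYE : (e + Y) * D = D * (e - Y) by rewrite mulrBr DY opprK De mulrDl eD.
split.
- by split; [rewrite mulrA mulrDr ee eX | rewrite -mulrA De].
- by split; [rewrite mulrA eD | rewrite -mulrA mulrDl ee Ye].
- have E : (e + X) * (e - X) = e.
    by rewrite mulrDl !mulrBr ee eX Xe XX subr0 subrK.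
  by rewrite mulrA -[_ * (e + X)]mulrA DXE mulrA E eD DD.
- have E : (e - Y) * (e + Y) = e.
    by rewrite mulrBl !mulrDr ee eY Ye YY addr0 addrK.
  by rewrite mulrA -[_ * D]mulrA DYE mulrA DD -mulrA E ee.
by rewrite BE mulrA -[_ * D * D]mulrA DD [(e + X) * e]mulrDl ee Xe.
Qed.
End Corner.

Definition nilpotent (A : pzRingType) (x : A) := exists k, x ^+ k = 0.

(** When [R P = 1], the map [X |-> P X R] embeds a matrix algebra as the corner
    of the idempotent [P R]. *)
Lemma lift_mul (F : fieldType) n m (P : 'M[F]_(n, m)) (R : 'M_(m, n)) X Y :
  R *m P = 1%:M -> (P *m X *m R) *m (P *m Y *m R) = P *m (X *m Y) *m R.
Proof.
by move=> RP; rewrite !mulmxA -[_ *m R *m P]mulmxA RP mulmx1.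
Qed.

Lemma lift_exp (F : fieldType) n m (P : 'M[F]_(n, m)) (R : 'M_(m, n)) X k :
  R *m P = 1%:M -> (P *m X *m R) ^+ k.+1 = P *m (X ^+ k.+1) *m R.
Proof.
move=> RP; elim: k => [|k IH]; first by rewrite !expr1.
by rewrite exprS IH -mulmxE lift_mul // mulmxE -exprS.
Qed.

Lemma nilpotent_lift (F : fieldType) n m (P : 'M[F]_(n, m)) (R : 'M_(m, n)) X :
  R *m P = 1%:M -> nilpotent _ X -> nilpotent _ (P *m X *m R).
Proof.
move=> RP [k Xk]; exists k.+1.
by rewrite lift_exp // exprS Xk mulr0 mulmx0 mul0mx.
Qed.

Lemma block_exp (F : fieldType) n m (X : 'M[F]_n) (Y : 'M_(n, m)) (Z : 'M_m) k :
  exists W, block_mx X Y 0 Z ^+ k = block_mx (X ^+ k) W 0 (Z ^+ k).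
Proof.
elim: k => [|k [W IH]]; first by exists 0; rewrite !expr0 -scalar_mx_block.
exists (X *m W + Y *m Z ^+ k).
by rewrite !exprS IH -mulmxE mulmx_block !mul0mx !mulmx0 !(addr0, add0r).
Qed.

Lemma nilpotent_block (F : fieldType) n m (X : 'M[F]_n) (Y : 'M_(n, m)) (Z : 'M_m) :
  nilpotent _ X -> nilpotent _ Z -> nilpotent _ (block_mx X Y 0 Z).
Proof.
move=> [k Xk] [l Zl]; exists ((k + l) + (k + l))%N.
have [W E] := block_exp _ _ _ X Y Z (k + l).
rewrite exprD E !exprD Xk Zl mul0r mulr0 -mulmxE mulmx_block.
by rewrite !mulmx0 !mul0mx !addr0 block_mx0.
Qed.

(** [B P = P G] says that the column space of [P] is invariant under [B], which
    acts on it as [G]. *)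
Lemma graded_lift (F : fieldType) n m (P : 'M[F]_(n, m)) (R : 'M_(m, n)) B G :
  R *m P = 1%:M -> B *m P = P *m G ->
  graded_pair 'M_m 1 G -> graded_pair 'M_n (P *m R) B.
Proof.
move=> RP BP [X [Y [D [_ [[XX YY DD] [DX DY GE]]]]]].
have PR : P *m R = P *m 1%:M *m R by rewrite mulmx1.
have L := lift_mul _ _ _ _ _ _ _ RP.
have C Z : in_corner 'M_n (P *m R) (P *m Z *m R).
  by rewrite PR; split; rewrite -mulmxE L ?mul1mx ?mulmx1.
exists (P *m X *m R), (P *m Y *m R), (P *m D *m R); split=> //.
rewrite -!mulmxE in XX YY DD DX DY GE *.
rewrite !L XX YY DD DX DY !(mulmx0, mul0mx, mulmxN, mulNmx) mulmx1.
do 2!split=> //.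
rewrite PR -!mulmxDl -!mulmxDr L -GE.
by rewrite !mulmxA BP /GRing.one /= !mulmx1.
Qed.

Lemma involution_lift (F : fieldType) n m (P : 'M[F]_(n, m)) (R : 'M_(m, n)) B G :
  R *m P = 1%:M -> B *m P = P *m G ->
  involution_pair 'M_m 1 G -> involution_pair 'M_n (P *m R) B.
Proof.
move=> RP BP [s [t [_ _ ss tt GE]]].
have PR : P *m R = P *m 1%:M *m R by rewrite mulmx1.
have L := lift_mul _ _ _ _ _ _ _ RP.
have C Z : in_corner 'M_n (P *m R) (P *m Z *m R).
  by rewrite PR; split; rewrite -mulmxE L ?mul1mx ?mulmx1.
rewrite -!mulmxE in ss tt GE.
exists (P *m s *m R), (P *m t *m R); split=> //; rewrite -mulmxE ?L ?ss ?tt ?mulmx1 //.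
by rewrite -GE mulmxA BP /GRing.one /= !mulmx1.
Qed.

(** The column space of [P] and the kernel of [R] are invariant complementary
    subspaces, and [P R] is the projector on the former along the latter. *)
Lemma lift_commute (F : fieldType) n m (P : 'M[F]_(n, m)) (R : 'M_(m, n)) B G G' :
  R *m P = 1%:M -> B *m P = P *m G -> R *m B = G' *m R ->
  B *m (P *m R) = (P *m R) *m B.
Proof.
move=> RP BP RB; rewrite mulmxA BP -[RHS]mulmxA RB.
have := congr1 (mulmx R) BP; rewrite !mulmxA RP mul1mx RB -mulmxA RP mulmx1 => ->.
by [].
Qed.

(** * Unipotent matrices *)

(** The entries of the nilpotent shift in the columns of a given parity. A step
    out of an odd column lands in an even one, so each part has square 0. *)
Definition shift_part (F : fieldType) (b : bool) m : 'M[F]_m :=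
  \matrix_(i, j) ((i == j.+1 :> nat) && (odd j == b))%:R.

Definition sign_mx (F : fieldType) m : 'M[F]_m := diag_mx (\row_i (-1) ^+ i).

Lemma shift_part_mul (F : fieldType) b c m :
  shift_part F b m *m shift_part F c m =
  \matrix_(i, j) [&& i == j.+2 :> nat, b != c & odd j == c]%:R.
Proof.
apply/matrixP => i j; rewrite !mxE.
case: (ltnP j.+1 m) => [jm|mj]; last first.
  rewrite big1 => [|k _]; last first.
    by rewrite !mxE; case: (k =P j.+1 :> nat) => [kj|]; rewrite ?mulr0 //= -?kj;
       move: (ltn_ord k); rewrite kj ltnNge mj.
  by case: (i =P j.+2 :> nat) => //= ij; move: (ltn_ord i); rewrite ij ltnNge (leq_trans mj).
rewrite (bigD1 (Ordinal jm)) //= big1 => [|k /eqP kj]; last first.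
  rewrite !mxE; case: (k =P j.+1 :> nat) => [e|]; rewrite ?mulr0 //=.
  by case: kj; apply: val_inj.
rewrite !mxE addr0 /= eqxx /= -natrM mulnb.
by case: (i == j.+2 :> nat); case: b; case: c; case: (odd j).
Qed.

Lemma shift_part_sign (F : fieldType) b m :
  sign_mx F m *m shift_part F b m = - (shift_part F b m *m sign_mx F m).
Proof.
rewrite /sign_mx mul_diag_mx mul_mx_diag; apply/matrixP => i j; rewrite !mxE.
case: (i =P j.+1 :> nat) => [->|]; rewrite ?mulr0 ?mul0r ?oppr0 //=.
by rewrite exprS mulN1r mulNr [in RHS]mulrC.
Qed.

(** Both parts move the index by one, hence anticommute with the diagonal
    matrix of alternating signs. *)
Lemma graded_shift (F : fieldType) m :
  graded_pair 'M[F]_m 1 ((1 + shift_part F true m) * (1 + shift_part F false m)).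
Proof.
exists (shift_part F true m), (shift_part F false m), (sign_mx F m).
rewrite -!mulmxE !shift_part_sign /in_corner.
have Z b : shift_part F b m *m shift_part F b m = 0.
  by apply/matrixP => i j; rewrite shift_part_mul !mxE eqxx andbF.
split; first by split; split; rewrite -mulmxE ?mul1mx ?mulmx1.
do 2!split=> //; last by rewrite mulmx1.
rewrite /sign_mx mulmx_diag; apply/matrixP => i j; rewrite !mxE -expr2 sqrr_sign.
by [].
Qed.

Lemma sum_pick (F : fieldType) m (f : nat -> F) t :
  (forall k, (m <= k)%N -> f k = 0) ->
  \sum_(k < m) f k * (k == t :> nat)%:R = f t.
Proof.
move=> f0; case: (ltnP t m) => [tm|mt].
  rewrite (bigD1 (Ordinal tm)) //= eqxx mulr1 big1 ?addr0 // => k kt.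
  have /negPf -> : k != t :> nat by apply: contra kt => /eqP kt; apply/eqP/val_inj.
  by rewrite mulr0.
rewrite f0 // big1 // => k _; have /negPf -> : k != t :> nat.
  by rewrite neq_ltn (leq_trans (ltn_ord k) mt).
by rewrite mulr0.
Qed.

(** A chain of length [m + 1] for the nilpotent part [N = B - 1], with [b]
    playing the role of the inverse of [B]. The powers of [b] in [chain_vec] are
    there to make [B] act exactly as the product [(1 + X)(1 + Y)] of
    [graded_shift]: [N] sends an odd vector of the chain to its successor [c],
    and an even one to [c + c'] where [c'] is the successor of [c]. The row
    vectors [phi N^(m - i)] form a dual chain. *)
Section Chain.
Variables (F : fieldType) (n m : nat) (B b : 'M[F]_n).
Variables (x : 'cV[F]_n) (phi : 'rV[F]_n).
Local Notation N := (B - 1).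
Hypothesis bN : b * N = N * b.
Hypothesis Bbx : B *m (b *m x) = x.
Hypothesis Nx : N ^+ m.+1 *m x = 0.
Hypothesis Nphi : phi *m N ^+ m.+1 = 0.
Hypothesis phix : phi *m N ^+ m *m x = 1%:M.

Definition chain_vec j : 'cV[F]_n := N ^+ j *m (b ^+ uphalf j *m x).
Definition chain_mx : 'M[F]_(n, m.+1) := \matrix_(i, j) chain_vec j i 0.
Definition cochain_mx : 'M[F]_(m.+1, n) := \matrix_(i, j) (phi *m N ^+ (m - i)) 0 j.

Let comm_Nb i j : N ^+ i *m b ^+ j = b ^+ j *m N ^+ i.
Proof. by rewrite mulmxE; apply: commrX; apply: commr_sym; apply: commrX; exact: bN. Qed.

Let N_add i j : N ^+ i *m N ^+ j = N ^+ (i + j).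
Proof. by rewrite mulmxE exprD. Qed.

Let N_high t : (m < t)%N -> N ^+ t *m x = 0.
Proof. by move=> mt; rewrite -(subnK mt) exprD -mulmxE -mulmxA Nx mulmx0. Qed.

Let phi_high t : (m < t)%N -> phi *m N ^+ t = 0.
Proof.
by move=> mt; rewrite -(subnKC mt) exprD -mulmxE mulmxA Nphi mul0mx.
Qed.

Let BE : B = 1%:M + N. Proof. by rewrite addrC subrK. Qed.

Lemma chain_vec_high t : (m < t)%N -> chain_vec t = 0.
Proof. by move=> mt; rewrite /chain_vec mulmxA comm_Nb -mulmxA N_high ?mulmx0. Qed.

Let Nm_b : N ^+ m *m (b *m x) = N ^+ m *m x.
Proof.
have xE : x = b *m x + N *m (b *m x).
  by rewrite -[b *m x in X in X + _]mul1mx -mulmxDl -BE Bbx.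
rewrite [in RHS]xE mulmxDr.
suff -> : N ^+ m *m (N *m (b *m x)) = 0 by rewrite addr0.
have NN : N ^+ m *m N = N ^+ m.+1 by rewrite mulmxE -exprSr.
rewrite mulmxA NN mulmxA -[b]expr1 comm_Nb -mulmxA.
by rewrite N_high ?mulmx0.
Qed.

Let NmE u : N ^+ m *m (b ^+ u *m x) = N ^+ m *m x.
Proof.
elim: u => [|u IH]; first by rewrite expr0 mul1mx.
have -> : b ^+ u.+1 *m x = b ^+ u *m (b *m x) by rewrite exprSr -mulmxE mulmxA.
by rewrite mulmxA comm_Nb -mulmxA Nm_b mulmxA -comm_Nb -mulmxA.
Qed.

Let N_chain j : N *m chain_vec j =
  chain_vec j.+1 + (if odd j then 0 else chain_vec j.+2).
Proof.
rewrite /chain_vec mulmxA mulmxE -exprS.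
case: ifP => jo; first by rewrite addr0 /= uphalf_half jo.
have -> : uphalf j.+1 = (uphalf j).+1 by rewrite /= uphalf_half jo.
have -> : uphalf j.+2 = (uphalf j).+1 by [].
have -> : N ^+ j.+2 = N ^+ j.+1 *m N by rewrite exprSr.
rewrite -[_ *m N *m _]mulmxA -mulmxDr; congr (_ *m _).
rewrite -[X in X + _]mul1mx -mulmxDl -BE.
rewrite exprSr -mulmxE -[_ *m b *m x]mulmxA.
have -> : B *m (b ^+ uphalf j *m (b *m x)) = b ^+ uphalf j *m (B *m (b *m x)).
  by rewrite !mulmxA BE mulmxDl mulmxDr -{1}[N]expr1 comm_Nb expr1 mul1mx mulmx1.
by rewrite Bbx.
Qed.

Lemma chain_mxE : B *m chain_mx =
  chain_mx *m ((1 + shift_part F true m.+1) * (1 + shift_part F false m.+1)).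
Proof.
rewrite -mulmxE mulmxDr mulmx1 mulmxDl mul1mx shift_part_mul.
apply/matrixP => i j.
have -> : (B *m chain_mx) i j = (B *m chain_vec j) i 0.
  by rewrite !mxE; apply: eq_bigr => k _; rewrite mxE.
rewrite {1}BE mulmxDl mul1mx N_chain !mulmxDr mulmx1.
have P t (Q : 'M[F]_m.+1) c : (forall k, Q k j = (k == t :> nat)%:R * c) ->
    (chain_mx *m Q) i j = chain_vec t i 0 * c.
  move=> QE; rewrite mxE -(sum_pick _ m.+1 (fun k => chain_vec k i 0)); last first.
    by move=> k mk; rewrite chain_vec_high ?mxE.
  by rewrite mulr_suml; apply: eq_bigr => k _; rewrite QE mxE mulrA.
have add p q (Q Q' : 'M[F]_(p, q)) k l : (Q + Q') k l = Q k l + Q' k l by rewrite mxE.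
rewrite !add (P j.+1 _ (odd j == true)%:R) => [|k]; last by rewrite mxE -natrM mulnb.
rewrite (P j.+1 _ (odd j == false)%:R) => [|k]; last by rewrite mxE -natrM mulnb.
rewrite (P j.+2 _ (odd j == false)%:R) => [|k]; last by rewrite mxE -natrM mulnb.
by rewrite [chain_mx i j]mxE; case: (odd j); rewrite ?mxE /=; ring.
Qed.

Lemma cochain_mxE :
  cochain_mx *m B = (1%:M + \matrix_(i, j) (i == j.+1 :> nat)%:R) *m cochain_mx.
Proof.
rewrite {1}BE mulmxDr mulmx1 mulmxDl mul1mx; congr (_ + _).
apply/matrixP => i j.
have -> : (cochain_mx *m N) i j = (phi *m N ^+ (m - i).+1) 0 j.
  rewrite exprSr -mulmxE mulmxA !mxE; apply: eq_bigr => k _.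
  by rewrite !mxE.
case: i => [[|i] im]; rewrite [RHS]mxE.
  have -> : (m - Ordinal im).+1 = m.+1 by rewrite subn0.
  by rewrite Nphi mxE big1 // => k _; rewrite !mxE mul0r.
have -> : (m - Ordinal im).+1 = (m - i)%N by rewrite /= subnSK.
rewrite (bigD1 (Ordinal (ltnW im))) //= big1 => [|k /eqP ki]; last first.
  rewrite !mxE /=; case: eqP => [[ik]|]; rewrite ?mul0r //.
  by case: ki; apply: val_inj.
by rewrite addr0 !mxE /= eqxx mul1r.
Qed.

(** The pairing of both chains is lower triangular with ones on the diagonal,
    since [N^t] kills [x] for [t > m] and [N^m b = N^m] on [x]. *)
Lemma cochain_chain_unit : cochain_mx *m chain_mx \in unitmx.
Proof.
have HE i j : (cochain_mx *m chain_mx) i j =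
    (phi *m N ^+ (m - i) *m chain_vec j) 0 0.
  by rewrite !mxE; apply: eq_bigr => k _; rewrite !mxE.
have trig : is_trig_mx (cochain_mx *m chain_mx).
  apply/is_trig_mxP => i j ij; rewrite HE /chain_vec mulmxA.
  have -> : phi *m N ^+ (m - i) *m N ^+ j = 0.
    have lt : (m < m - i + j)%N by move: (ltn_ord i) ij; clear; lia.
    by rewrite -mulmxA N_add (phi_high _ lt).
  by rewrite mul0mx mxE.
rewrite unitmxE (det_trig trig) big1 ?unitr1 // => i _.
rewrite HE /chain_vec mulmxA.
have -> : phi *m N ^+ (m - i) *m N ^+ i = phi *m N ^+ m.
  have le : (i <= m)%N by rewrite -ltnS.
  by rewrite -mulmxA N_add (subnK le).
by rewrite -mulmxA NmE mulmxA phix mxE.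
Qed.
End Chain.

(** Induction on the rank of [e]. A chain of maximal length splits off: the
    annihilator of its dual chain is an invariant complement, whose projector
    is a smaller corner. *)
Lemma unipotent_graded (F : fieldType) n (B e : 'M[F]_n) k :
  e * e = e -> B * e = e * B -> (B - 1) ^+ k * e = 0 -> graded_pair 'M_n e B.
Proof.
elim: {e}_.+1 {-2}e (ltnSn (\rank e)) => // r IH e rke ee Be Nke.
have [->|e0] := eqVneq e 0.
  exists 0, 0, 0; rewrite /in_corner !mulr0 !addr0 mulr0 oppr0.
  by do ![split].
have Ne j : (B - 1) ^+ j * e = e * (B - 1) ^+ j.
  by apply/commr_sym/commrX/commr_sym; rewrite /GRing.comm mulrBl mulrBr Be mulr1 mul1r.
have exN : exists j, (B - 1) ^+ j * e == 0 by exists k; apply/eqP.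
case: (ex_minnP exN) => -[|m] /eqP Nm0 minm.
  by rewrite expr0 mul1r in Nm0; rewrite Nm0 eqxx in e0.
have Nm1 : (B - 1) ^+ m * e != 0.
  by apply/negP => /minm; rewrite ltnn.
have [i0 [j0 ij0]] : exists i j, ((B - 1) ^+ m * e) i j != 0.
  by move/matrix0Pn: Nm1.
set c := _ i0 j0 in ij0.
pose x : 'cV[F]_n := c^-1 *: (e *m delta_mx j0 0).
pose phi : 'rV[F]_n := delta_mx 0 i0 *m e.
(* A truncated Neumann series inverts B on the corner of e. *)
pose b := \sum_(i < m.+1) (1 - B) ^+ i.
have bN : b * (B - 1) = (B - 1) * b.
  apply/commr_sym/commr_sum => i _; apply: commrX.
  by rewrite -[1 - B]opprB; apply: commrN.
have be : b * e = e * b.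
  apply/commr_sym/commr_sum => i _; apply: commrX.
  by rewrite /GRing.comm mulrBl mulrBr Be mulr1 mul1r.
have Bbe : B * b * e = e.
  have : (1 - B) ^+ m.+1 * e = 0 by rewrite -opprB exprNn -mulrA Nm0 mulr0.
  have /(congr1 -%R) := subrX1 (1 - B) m.+1.
  rewrite -/b [1 - B - 1]addrAC subrr add0r mulNr opprB opprK => <- NB.
  by rewrite mulrBl NB mul1r subr0.
have ex : e *m x = x by rewrite -scalemxAr mulmxA [e *m e]ee.
have phie : phi *m e = phi by rewrite -mulmxA [e *m e]ee.
have Bbx : B *m (b *m x) = x.
  by rewrite -ex !mulmxA [B *m b *m e]Bbe.
have Nx : (B - 1) ^+ m.+1 *m x = 0.
  by rewrite -ex mulmxA [_ *m e]Nm0 mul0mx.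
have Nphi : phi *m (B - 1) ^+ m.+1 = 0.
  by rewrite -phie -mulmxA [e *m _](esym (Ne _)) Nm0 mulmx0.
have phix : phi *m (B - 1) ^+ m *m x = 1%:M.
  rewrite -scalemxAr -mulmxA [_ ^+ m *m _]mulmxA [_ ^+ m *m e]Ne /phi.
  rewrite !mulmxA -[_ *m e *m e]mulmxA [e *m e]ee -[_ *m e *m _]mulmxA [e *m _](esym (Ne _)).
  rewrite -rowE -colE; apply/matrixP => i j; rewrite !ord1 mxE.
  by rewrite [X in _ * X]mxE [X in _ * X]mxE -/c mulVf ?mxE.
pose P := chain_mx _ _ m B b x; pose R := cochain_mx _ _ m B phi.
have BP := chain_mxE _ _ m B b x bN Bbx Nx; rewrite -/P in BP.
have RB := cochain_mxE _ _ m B phi Nphi; rewrite -/R in RB.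
have uH := cochain_chain_unit _ _ m B b x phi bN Bbx Nx Nphi phix.
rewrite -/P -/R in uH.
pose R' := invmx (R *m P) *m R.
have RP : R' *m P = 1%:M by rewrite -mulmxA mulVmx.
have eP : e *m P = P.
  apply/matrixP => i j.
  transitivity ((e *m chain_vec _ _ B b x j) i 0).
    by rewrite !mxE; apply: eq_bigr => l _; rewrite !mxE.
  have eb u : e * b ^+ u = b ^+ u * e by apply: commrX; exact: esym be.
  rewrite [RHS]mxE /chain_vec !mulmxA [e *m _](esym (Ne _)) -[_ *m e *m _]mulmxA.
  by rewrite [e *m _]eb -[in LHS]mulmxA -[_ *m e *m x]mulmxA ex mulmxA.
have Re : R *m e = R.
  apply/matrixP => i j.
  transitivity ((phi *m (B - 1) ^+ (m - i) *m e) 0 j).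
    by rewrite !mxE; apply: eq_bigr => l _; rewrite !mxE.
  by rewrite [RHS]mxE -mulmxA [_ *m e]Ne mulmxA phie.
have R'e : R' *m e = R' by rewrite -mulmxA Re.
(* The projector on the span of the chain, along the annihilator of its dual. *)
pose f := P *m R'.
have ff : f * f = f by rewrite -mulmxE /f mulmxA -[_ *m R' *m P]mulmxA RP mulmx1.
have ef : e * f = f by rewrite -mulmxE /f mulmxA eP.
have fe : f * e = f by rewrite -mulmxE /f -mulmxA R'e.
have Bf : B * f = f * B.
  apply: (lift_commute _ _ _ _ _ _ _ (invmx (R *m P) *m
    (1%:M + \matrix_(i, j) (i == j.+1 :> nat)%:R) *m (R *m P)) RP BP).
  rewrite /R'; move: (R *m P) uH => H uH.
  by rewrite -[LHS]mulmxA RB !mulmxA mulmxK.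
have gf : graded_pair 'M_n f B by apply: graded_lift RP BP (graded_shift F m.+1).
have e1e1 : (e - f) * (e - f) = e - f by rewrite mulrBl !mulrBr ee ef fe ff subrr subr0.
have ge : graded_pair 'M_n (e - f) B.
  apply: IH => //; last by rewrite mulrBr -[in X in _ - X]ef mulrA Nke mul0r subr0.
    rewrite ltnS in rke; apply: leq_trans rke.
    rewrite (ltn_leqif (mxrank_leqif_sup _)); last first.
      have {1}-> : e - f = (e - f) *m e by rewrite [_ *m e]mulrBl ee fe.
      exact: submxMl.
    apply/negP => /submxP[Q eQ].
    have : P = 0.
      rewrite -eP eQ -mulmxA mulmxBl eP /f -mulmxA RP mulmx1 subrr mulmx0 //.
    move=> P0; move: RP; rewrite P0 mulmx0 => /matrixP/(_ ord0 ord0).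
    by rewrite !mxE => /eqP; rewrite eq_sym oner_eq0.
  by rewrite mulrBr mulrBl Be Bf.
rewrite -[e](subrK f); apply: graded_pair_add => //.
  by rewrite mulrBl ef ff subrr.
by rewrite mulrBr fe ff subrr.
Qed.

(** The quotient [R] of the space carries the action [J], and the kernel of
    [R] is unipotent for [B]. As 1 is not an eigenvalue of [J], the quotient
    lifts to an invariant subspace: [(B - 1)^k] kills the kernel of [R], so
    correcting the section [S] to [(B - 1)^k S (J - 1)^-k] makes it
    equivariant. *)
Lemma split_block (F : fieldType) n m (B : 'M[F]_n) (R : 'M_(m, n)) (S : 'M_(n, m))
    (J : 'M_m) k :
  R *m B = J *m R -> R *m S = 1%:M -> (B - 1) ^+ k *m (1%:M - S *m R) = 0 ->
  J - 1 \in unitmx ->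
  exists f : 'M[F]_n, [/\ f * f = f,
    graded_pair 'M_m 1 J -> graded_pair 'M_n f B,
    involution_pair 'M_m 1 J -> involution_pair 'M_n f B
    & graded_pair 'M_n (1 - f) B].
Proof.
move=> RB RS NS uJ.
have RBk l : R *m (B - 1) ^+ l = (J - 1) ^+ l *m R.
  elim: l => [|l IH]; first by rewrite !expr0 mulmx1 mul1mx.
  rewrite exprSr -mulmxE mulmxA IH -mulmxA mulmxBr mulmx1 RB.
  by rewrite exprSr -mulmxE -mulmxA mulmxBl mul1mx.
have uJk : (J - 1) ^+ k \in unitmx.
  elim: k {NS} => [|l IH]; first by rewrite expr0 unitmx1.
  by rewrite exprS -mulmxE unitmx_mul uJ.
pose c := invmx ((J - 1) ^+ k).
pose P := (B - 1) ^+ k *m S *m c.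
have RP : R *m P = 1%:M by rewrite !mulmxA RBk -[_ *m R *m S]mulmxA RS mulmx1 mulmxV.
have BNk : B *m (B - 1) ^+ k = (B - 1) ^+ k *m B.
  by apply: commrX; rewrite /GRing.comm mulrBl mulrBr mulr1 mul1r.
have JNk : J *m (J - 1) ^+ k = (J - 1) ^+ k *m J.
  by apply: commrX; rewrite /GRing.comm mulrBl mulrBr mulr1 mul1r.
have Jc : J *m c = c *m J.
  rewrite -[LHS](mulKmx uJk) -/c; congr (c *m _).
  by rewrite mulmxA -JNk -mulmxA mulmxV // mulmx1.
have NBS : (B - 1) ^+ k *m (B *m S) = (B - 1) ^+ k *m (S *m J).
  apply/eqP; rewrite -subr_eq0 -mulmxBr; apply/eqP.
  have -> : B *m S - S *m J = (1%:M - S *m R) *m (B *m S - S *m J).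
    suff R0 : R *m (B *m S - S *m J) = 0.
      by rewrite mulmxBl mul1mx -[S *m R *m _]mulmxA R0 mulmx0 subr0.
    by rewrite mulmxBr !mulmxA RB -[J *m R *m S]mulmxA RS mulmx1 mul1mx subrr.
  by rewrite mulmxA NS mul0mx.
have BP : B *m P = P *m J.
  rewrite /P !mulmxA BNk -[_ *m B *m S]mulmxA NBS -!mulmxA.
  by rewrite Jc.
have Bf := lift_commute _ _ _ _ _ _ _ _ RP BP RB.
have ff : (P *m R) * (P *m R) = P *m R.
  by rewrite -mulmxE mulmxA -[_ *m R *m P]mulmxA RP mulmx1.
exists (P *m R); split=> //; [exact: graded_lift | exact: involution_lift |].
apply: (unipotent_graded _ _ _ _ k).
- by rewrite mulrBl !mulrBr ff !mulr1 !mul1r subrr subr0.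
- by rewrite mulrBr mulrBl !mulr1 !mul1r; congr (_ - _).
have -> : 1 - P *m R = (1%:M - S *m R) *m (1 - P *m R).
  have R0 : R *m (1 - P *m R) = 0 by rewrite mulmxBr mulmx1 mulmxA RP mul1mx subrr.
  by rewrite mulmxBl mul1mx -[S *m R *m _]mulmxA R0 mulmx0 subr0.
by rewrite -mulmxE mulmxA NS mul0mx.
Qed.

(** Unipotence on the kernel of [R] can be tested after composing with any
    projector [1 - S R] onto it, because that kernel is invariant. *)
Lemma split_nilpotent (F : fieldType) m p (B : 'M[F]_m) (R : 'M_(p, m)) (S : 'M_(m, p)) (J : 'M_p) :
  R *m B = J *m R -> R *m S = 1%:M -> J - 1 \in unitmx ->
  nilpotent _ ((B - 1) *m (1%:M - S *m R)) ->
  exists f : 'M[F]_m, [/\ f * f = f,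
    graded_pair 'M_p 1 J -> graded_pair 'M_m f B,
    involution_pair 'M_p 1 J -> involution_pair 'M_m f B
    & graded_pair 'M_m (1 - f) B].
Proof.
move=> RB RS uJ [k nB]; apply: (split_block _ _ _ _ _ _ _ k RB RS) => //.
set Pi := 1%:M - S *m R in nB *.
have RPi : R *m Pi = 0 by rewrite mulmxBr mulmx1 mulmxA RS mul1mx subrr.
have RE l : R *m ((B - 1) ^+ l *m Pi) = 0.
  elim: l => [|l IH]; first by rewrite expr0 mul1mx.
  by rewrite exprS -mulmxE -mulmxA mulmxA mulmxBr mulmx1 RB mulmxBl -!mulmxA IH mulmx0 subr0.
have E l : (B - 1) ^+ l *m Pi = ((B - 1) *m Pi) ^+ l *m Pi.
  elim: l => [|l IH]; first by rewrite !expr0.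
  have PE : Pi *m ((B - 1) ^+ l *m Pi) = (B - 1) ^+ l *m Pi.
    by rewrite {1}/Pi mulmxBl mul1mx -[S *m R *m _]mulmxA RE mulmx0 subr0.
  rewrite [in RHS]exprS -[RHS]mulmxA -IH -[RHS]mulmxA PE.
  by rewrite exprS -mulmxE mulmxA.
by rewrite E nB mul0mx.
Qed.

(** * A Sourour factorization of nonscalar matrices *)

Section Rows.
Variables (F : fieldType) (n : nat).
Implicit Types (x y z v w : 'rV[F]_n) (A : 'M[F]_n).

Lemma sub_row2P x y z :
  reflect (exists a b, x = a *: y + b *: z) (x <= col_mx y z)%MS.
Proof.
apply: (iffP submxP) => [[D ->]|[a [b ->]]]; last first.
  by exists (row_mx a%:M b%:M); rewrite mul_row_col !mul_scalar_mx.
exists (lsubmx D 0 0), (rsubmx D 0 0).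
by rewrite -{1}[D]hsubmxK mul_row_col {1}[lsubmx D]mx11_scalar
  {1}[rsubmx D]mx11_scalar !mul_scalar_mx.
Qed.

Lemma row_free_cons p x (X : 'M[F]_(p, n)) :
  row_free X -> ~~ (x <= X)%MS -> row_free (col_mx x X).
Proof.
move=> fX xX; rewrite -kermx_eq0; apply/eqP/row_matrixP => i; rewrite row0.
have : row i (kermx (col_mx x X)) *m col_mx x X = 0 by rewrite -row_mul mulmx_ker row0.
move: (row i _) => r; rewrite -[r]hsubmxK mul_row_col [lsubmx r]mx11_scalar mul_scalar_mx.
move: (lsubmx r 0 0) (rsubmx r) => a s.
have [->|a0] := eqVneq a 0.
  by rewrite scale0r add0r raddf0 => /(canRL (mulmxKp fX)); rewrite mul0mx => ->; rewrite row_mx0.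
move/eqP; rewrite addr_eq0 => /eqP E; case/negP: xX.
by rewrite -[x](scalerK a0) scalemx_sub // E -mulNmx submxMl.
Qed.

Lemma row_free_values p (X : 'M[F]_(p, n)) (c : 'cV_p) :
  row_free X -> exists phi : 'cV_n, X *m phi = c.
Proof. by move=> fX; exists (pinvmx X *m c); rewrite mulmxA mulmxVp // mul1mx. Qed.

Lemma nonscalar_row A : ~~ is_scalar_mx A -> exists w, ~~ (w *m A <= w)%MS.
Proof.
move=> nA; apply: contrapT => nw; case/negP: nA.
have eig w : exists a, w *m A = a *: w.
  apply/sub_rVP; apply/negPn/negP => h; apply: nw; by exists w.
have Aij i j : i != j -> A i j = 0.
  move=> ij; have [a] := eig (delta_mx 0 i); rewrite -rowE => /rowP/(_ j).
  by rewrite !mxE eqxx [j == i]eq_sym (negPf ij) mulr0.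
have Aii i j : A i i = A j j.
  have [->//|ij] := eqVneq i j.
  have [a E] := eig (delta_mx 0 i + delta_mx 0 j).
  have /rowP/(_ i) := E; have /rowP/(_ j) := E.
  have ji : j != i by rewrite eq_sym.
  rewrite mulmxDl -!rowE !mxE !eqxx (negPf ij) (negPf ji) (Aij _ _ ij) (Aij _ _ ji) /=.
  by rewrite !add0r !addr0 => -> ->.
apply/is_scalar_mxP; case: n A Aij Aii {nw eig} => [|k] A Aij Aii.
  by exists 0; apply/matrixP; case.
exists (A 0 0); apply/matrixP => i j; rewrite !mxE.
by have [<-|/Aij] := eqVneq i j; first exact: Aii.
Qed.

(** [v] and [phi] may start a basis and its dual basis in which the first
    diagonal entry of [A] is [alpha]. *)
Definition pivot A (alpha : F) v (phi : 'cV[F]_n) :=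
  v *m phi = 1%:M /\ v *m A *m phi = alpha%:M.

(** When [v], [v A] and [w A] are linearly independent, [phi] may take any
    values on them. The vector [w] is there to exclude scalar Schur complements
    (see [schur_scalar]). *)
Lemma pivot_exists A alpha : A \in unitmx -> ~~ is_scalar_mx A ->
  exists v phi, pivot A alpha v phi /\
   ((2 < n)%N -> exists2 w, w *m A *m phi = 0 & forall a b, w <> a *: v + b *: (w *m A)).
Proof.
move=> uA /nonscalar_row[w wA].
have w0 : w != 0 by apply: contraNneq wA => ->; rewrite mul0mx sub0mx.
have fw : row_free w by rewrite /row_free rank_rV w0.
have fwA : row_free (w *m A) by rewrite /row_free mxrankMfree ?row_free_unit // rank_rV w0.
have f2 := row_free_cons _ _ _ fw wA.
have [n2|n3] : (n <= 2)%N \/ (2 < n)%N by case: ltnP; [right|left].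
  have [phi] := row_free_values _ _ (col_mx alpha%:M 1%:M) f2.
  rewrite mul_col_mx => /eq_col_mx[h1 h2]; exists w, phi; split; first by split.
  by rewrite ltnNge n2.
(* From here on any v outside the span of w and w A serves, or else v + w does. *)
have [v vW] : exists v, ~~ (v <= col_mx (w *m A) w)%MS.
  apply: contrapT => nv; suff : (1%:M <= col_mx (w *m A) w)%MS.
    move/mxrankS; rewrite mxrank1 leqNgt => /negP; apply.
    by apply: leq_ltn_trans (rank_leq_row _) n3.
  by apply/row_subP => i; apply/negPn/negP => h; apply: nv; eexists; exact: h.
have free3 a b c : a *: v + b *: w + c *: (w *m A) = 0 -> [/\ a = 0, b = 0 & c = 0].
  move=> E; have : row_mx a%:M (row_mx c%:M b%:M) *m col_mx v (col_mx (w *m A) w) = 0.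
    by rewrite !mul_row_col !mul_scalar_mx -E -addrA [b *: _ + _]addrC.
  move/(canRL (mulmxKp (row_free_cons _ _ _ f2 vW))); rewrite mul0mx.
  have sc (d : F) : d%:M = 0 :> 'M_1 -> d = 0.
    by move/matrixP/(_ 0 0); rewrite !mxE.
  move=> E0; have : row_mx a%:M (row_mx c%:M b%:M) =
      row_mx (0 : 'M[F]_1) (row_mx (0 : 'M_1) (0 : 'M_1)).
    by rewrite E0 !row_mx0.
  by move=> /eq_row_mx[/sc -> /eq_row_mx[/sc -> /sc ->]].
have fv u : (forall a b c, a *: u + b *: w + c *: (w *m A) = 0 -> [/\ a = 0, b = 0 & c = 0]) ->
    ~~ (u *m A <= col_mx u (w *m A))%MS ->
  exists v phi, pivot A alpha v phi /\
   ((2 < n)%N -> exists2 w, w *m A *m phi = 0 & forall a b, w <> a *: v + b *: (w *m A)).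
  move=> f3 uAX.
  have fX : row_free (col_mx u (w *m A)).
    apply: row_free_cons => //; apply/sub_rVP => -[a uE].
    have [] := f3 1 0 (- a); first by rewrite uE scale1r scale0r addr0 scaleNr subrr.
    by move/eqP; rewrite oner_eq0.
  have [phi] := row_free_values _ _ (col_mx alpha%:M (col_mx 1%:M 0)) (row_free_cons _ _ _ fX uAX).
  rewrite !mul_col_mx => /eq_col_mx[h1 /eq_col_mx[h2 h3]].
  exists u, phi; split=> // _; exists w => // a b E.
  have [] := f3 a (-1) b; first by rewrite scaleN1r addrAC -E subrr.
  by move=> _ /eqP; rewrite oppr_eq0 oner_eq0.
have [/sub_row2P[b [g vE]]|] := boolP (v *m A <= col_mx v (w *m A))%MS; last exact: fv free3.
apply: (fv (v + w)).
  move=> a b' c; rewrite scalerDr -!addrA [a *: w + _]addrA -scalerDl addrA => /free3[-> h ->].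
  by move: h; rewrite add0r => ->.
apply/negP => /sub_row2P[b' [g' E]].
have [] := free3 (b - b') (- b') (g + 1 - g').
  apply/eqP; rewrite -[_ == 0]subr_eq0 subr0; move/eqP: E.
  rewrite mulmxDl vE -subr_eq0 => /eqP <-; apply/eqP/rowP => i; rewrite !mxE; ring.
move=> /eqP; rewrite subr_eq0 => /eqP bb /eqP; rewrite oppr_eq0 => /eqP b'0 _.
move: vE; rewrite bb b'0 scale0r add0r scalemxAl => /(can_inj (mulmxK uA)) vw.
have [] := free3 1 (- g) 0; first by rewrite vw scale1r scale0r addr0 scaleNr subrr.
by move/eqP; rewrite oner_eq0.
Qed.
End Rows.

Lemma det_conj (F : fieldType) n p (A : 'M[F]_n) (G : 'M_(p, n)) (H : 'M_(n, p)) :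
  G *m H = 1%:M -> H *m G = 1%:M -> \det (G *m A *m H) = \det A.
Proof.
move=> GH HG.
have pn : p = n.
  apply/eqP; rewrite eqn_leq -{1}(mxrank1 F p) -{2}(mxrank1 F n) -GH -HG.
  by rewrite !(leq_trans (mxrankM_maxl _ _)) ?rank_leq_col.
subst p; rewrite !det_mulmx mulrAC -det_mulmx GH det1 mul1r //.
Qed.

(** [X] vanishes on a quotient line, so it is nilpotent as soon as it is so on
    the kernel of that quotient. *)
Lemma nilpotent_of_fixed_row (F : fieldType) n (X : 'M[F]_n) (eps : 'rV_n) (tau : 'cV_n) :
  eps *m X = 0 -> nilpotent _ (X *m (1%:M - tau *m eps)) -> nilpotent 'M_n X.
Proof.
move=> eX [k Xk]; exists k.+1.
have E l : (X *m (1%:M - tau *m eps)) ^+ l *m X = X ^+ l.+1.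
  elim: l => [|l IH]; first by rewrite expr0 expr1 mul1mx.
  have e0 : eps *m X ^+ l.+1 = 0 by rewrite exprS -mulmxE mulmxA eX mul0mx.
  rewrite exprS -[LHS]mulmxA IH -mulmxA mulmxBl mul1mx -mulmxA e0 mulmx0 subr0.
  by rewrite [in RHS]exprS.
by rewrite -E Xk mul0mx.
Qed.

Section PivotSplit.
Variables (F : fieldType) (n : nat) (A : 'M[F]_n) (alpha : F).
Variables (v : 'rV[F]_n) (phi : 'cV[F]_n).
Hypotheses (alpha0 : alpha != 0) (piv : pivot _ _ A alpha v phi).

(** [H] and [K] come from a rank factorization of the projector
    [1 - phi v]. *)
Lemma pivot_frame : exists m (H : 'M[F]_(n, m)) (K : 'M_(m, n)),
  [/\ (m < n)%N, K *m H = 1%:M, K *m phi = 0, v *m H = 0 & H *m K + phi *m v = 1%:M].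
Proof.
have [vphi _] := piv.
pose E := 1%:M - phi *m v.
have EE : E *m E = E.
  rewrite {1}/E mulmxBl mul1mx -mulmxA /E mulmxBr mulmx1 mulmxA vphi mul1mx subrr.
  by rewrite mulmx0 subr0.
have [C [R [HK fC fR]]] : exists (C : 'M_(n, \rank E)) (R : 'M_(\rank E, n)),
    [/\ C *m R = E, row_full C & row_free R].
  by exists (col_base E), (row_base E); rewrite mulmx_base col_base_full row_base_free.
exists (\rank E), C, R.
have injH p (X Y : 'M_(_, p)) : C *m X = C *m Y -> X = Y.
  have /row_fullP[L LH] := fC.
  by move=> /(congr1 (mulmx L)); rewrite !mulmxA LH !mul1mx.
have injK p (X Y : 'M_(p, _)) : X *m R = Y *m R -> X = Y.
  have /row_freeP[L LH] := fR.
  by move=> /(congr1 (mulmx^~ L)); rewrite /= -!mulmxA LH !mulmx1.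
have Ephi : E *m phi = 0 by rewrite mulmxBl mul1mx -mulmxA vphi mulmx1 subrr.
have vE : v *m E = 0 by rewrite mulmxBr mulmx1 mulmxA vphi mul1mx subrr.
split.
- rewrite ltn_neqAle rank_leq_row andbT; apply/negP => rE.
  have uE : E \in unitmx by rewrite -row_free_unit.
  move: vphi; have -> : phi = 0 by rewrite -[phi](mulKmx uE) Ephi mulmx0.
  by rewrite mulmx0 => /matrixP/(_ 0 0); rewrite !mxE => /eqP; rewrite eq_sym oner_eq0.
- apply: injH; apply: injK; rewrite mulmx1.
  by rewrite mulmxA HK -mulmxA HK EE.
- by apply: injH; rewrite mulmxA HK Ephi mulmx0.
- by apply: injK; rewrite -mulmxA HK vE mul0mx.
by rewrite HK subrK.
Qed.

Variables (m : nat) (H : 'M[F]_(n, m)) (K : 'M[F]_(m, n)).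
Hypotheses (KH : K *m H = 1%:M) (Kphi : K *m phi = 0) (vH : v *m H = 0).
Hypothesis HKv : H *m K + phi *m v = 1%:M.

(** The Schur complement of the entry [alpha] of [A], in the basis formed by
    [phi] and the columns of [H], whose dual basis is [v] and the rows of [K]. *)
Definition schur := K *m A *m H - alpha^-1 *: (K *m A *m phi *m (v *m A *m H)).

Let G := col_mx v K.
Let G' := row_mx phi H.
Let GG' : G *m G' = 1%:M.
Proof. by rewrite mul_col_row piv.1 vH Kphi KH -scalar_mx_block. Qed.
Let G'G : G' *m G = 1%:M.
Proof. by rewrite mul_row_col addrC. Qed.

Let AE : A = G' *m block_mx alpha%:M (v *m A *m H) (K *m A *m phi) (K *m A *m H) *m G.
Proof.
have <- : G *m A *m G' = block_mx alpha%:M (v *m A *m H) (K *m A *m phi) (K *m A *m H).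
  by rewrite mul_col_mx mul_col_row piv.2.
by rewrite !mulmxA G'G mul1mx -mulmxA G'G mulmx1.
Qed.

Let blockE (M1 N1 : 'M[F]_m) : schur = M1 *m N1 ->
  block_mx alpha%:M (v *m A *m H) (K *m A *m phi) (K *m A *m H) =
  block_mx (alpha%:M : 'M_1) (0 : 'M_(1, m)) (K *m A *m phi) M1 *m
  block_mx 1%:M (alpha^-1 *: (v *m A *m H)) (0 : 'M_(m, 1)) N1.
Proof.
move=> S; rewrite mulmx_block !mulmx1 !mul0mx !mulmx0 !addr0 mul_scalar_mx scalerA.
by rewrite divff // scale1r -S /schur -scalemxAr addrC subrK.
Qed.

Lemma det_schur : \det A = alpha * \det schur.
Proof.
rewrite -(det_conj _ _ _ A G G') // {1}AE !mulmxA GG' mul1mx -mulmxA GG' mulmx1.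
rewrite (blockE schur 1%:M) ?mulmx1 // det_mulmx det_lblock det_ublock.
by rewrite det_scalar1 !det1 !mulr1.
Qed.

(** The block LU factorization with the pivot [alpha] put in the lower factor:
    a factorization of the Schur complement fits into the lower right
    corners. *)
Lemma schur_factor (M1 N1 : 'M[F]_m) : schur = M1 *m N1 ->
  nilpotent 'M_m (M1 - 1) -> nilpotent 'M_m (N1 - 1) ->
  exists M N : 'M[F]_n, [/\ A = M *m N, nilpotent 'M_n (N - 1),
    nilpotent 'M_n ((M - 1) *m (1%:M - phi *m v)) & v *m M = alpha *: v].
Proof.
move=> S nM nN; exists (G' *m block_mx alpha%:M 0 (K *m A *m phi) M1 *m G).
exists (G' *m block_mx 1%:M (alpha^-1 *: (v *m A *m H)) 0 N1 *m G).
split.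
- rewrite lift_mul // -blockE //; exact: AE.
- rewrite -[1 : 'M_n]G'G -{2}[G']mulmx1 -mulmxBl -mulmxBr.
  apply: nilpotent_lift => //; rewrite scalar_mx_block opp_block_mx add_block_mx.
  rewrite !subrr subr0; apply: nilpotent_block => //; by exists 1%N; rewrite expr1.
- have -> : 1%:M - phi *m v = H *m K by rewrite -HKv addrK.
  have -> : (G' *m block_mx alpha%:M 0 (K *m A *m phi) M1 *m G - 1) *m (H *m K) =
      H *m (M1 - 1) *m K.
    have GH : G *m H = col_mx 0 1%:M by rewrite mul_col_mx vH KH.
    rewrite mulmxBl mul1mx mulmxA -[_ *m G *m H]mulmxA GH -[_ *m col_mx _ _]mulmxA.
    rewrite mul_block_col !mulmx0 !mul0mx !add0r mulmx1 mul_row_col mulmx0 add0r.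
    by rewrite mulmxBr mulmx1 mulmxBl.
  exact: nilpotent_lift.
have vG' : v *m G' = row_mx 1%:M 0 by rewrite mul_mx_row piv.1 vH.
rewrite !mulmxA vG' mul_row_block !mul1mx !mul0mx !addr0.
by rewrite mul_row_col mul0mx addr0 mul_scalar_mx.
Qed.

Lemma schur_scalar lam (w : 'rV[F]_n) : w *m A *m phi = 0 -> schur = lam%:M ->
  w *m A = lam *: (w - (w *m phi) *m v).
Proof.
move=> wA S.
have HK : H *m K = 1%:M - phi *m v by rewrite -HKv addrK.
pose w' := w *m (H *m K).
have w'E : w' = w - w *m phi *m v by rewrite /w' HK mulmxBr mulmx1 mulmxA.
have w'Aphi : w' *m A *m phi = - alpha *: (w *m phi).
  rewrite w'E !mulmxBl wA sub0r -!mulmxA [v *m (A *m _)]mulmxA.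
  by rewrite piv.2 mul_mx_scalar scaleNr scalemxAr.
have : w *m H *m schur *m K = lam *: w'.
  by rewrite S mul_mx_scalar -scalemxAl -mulmxA.
rewrite w'E => <-; rewrite /schur mulmxBr mulmxBl -scalemxAr -scalemxAl.
have -> : w *m H *m (K *m A *m phi *m (v *m A *m H)) = w' *m A *m phi *m (v *m A *m H).
  by rewrite /w' !mulmxA.
rewrite w'Aphi -!scalemxAl scaleNr scalerN scalerA mulVf // scale1r opprK.
have -> : w *m H *m (K *m A *m H) *m K = w' *m A *m (H *m K) by rewrite /w' !mulmxA.
have wAHK : w *m A *m (H *m K) = w *m A.
  by rewrite HK mulmxBr mulmx1 mulmxA wA mul0mx subr0.
by rewrite w'E !mulmxBl wAHK !mulmxA subrK.
Qed.
End PivotSplit.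

(** Choose a pivot equal to [det A], so that the Schur complement has
    determinant 1. If it is not scalar, the induction hypothesis splits it into
    two unipotent factors. In dimension greater than 2 it cannot be
    scalar, by the choice of [w]; in dimension at most 2 its size is at most
    1, and it is the identity. *)
Theorem unipotent_factorization (F : fieldType) n (A : 'M[F]_n) :
  A \in unitmx -> ~~ is_scalar_mx A ->
  exists (M N : 'M_n) (eps : 'rV_n) (tau : 'cV_n),
  [/\ A = M *m N, nilpotent 'M_n (N - 1),
      nilpotent 'M_n ((M - 1) *m (1%:M - tau *m eps)),
      eps *m M = \det A *: eps & eps *m tau = 1%:M].
Proof.
elim: {n}n.+1 {-2}n (ltnSn n) A => // d IH n; rewrite ltnS => nd A uA sA.
have dA : \det A != 0 by rewrite -unitfE -unitmxE.
have [v [phi [piv wP]]] := pivot_exists _ _ A (\det A) uA sA.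
have [m [H [K [mn KH Kphi vH HKv]]]] := pivot_frame _ _ _ _ _ _ piv.
have detS := det_schur _ _ _ _ _ _ dA piv _ _ _ KH Kphi vH HKv.
set S := schur _ _ _ _ _ _ _ H K in detS.
have detS1 : \det S = 1 by apply: (mulfI dA); rewrite -detS mulr1.
suff [M1 [N1 [S1 nM nN]]] : exists M1 N1 : 'M_m,
    [/\ S = M1 *m N1, nilpotent 'M_m (M1 - 1) & nilpotent 'M_m (N1 - 1)].
  have [M [N [AE NN MM vM]]] :=
    schur_factor _ _ _ _ _ _ dA piv _ _ _ KH Kphi vH HKv _ _ S1 nM nN.
  by exists M, N, v, phi; split=> //; exact: piv.1.
have [sS|sS] := boolP (is_scalar_mx S); last first.
  have uS : S \in unitmx by rewrite unitmxE detS1 unitr1.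
  have [M [N [eps [tau [SE nN nM epsM et]]]]] := IH m (leq_trans mn nd) S uS sS.
  exists M, N; split=> //; apply: nilpotent_of_fixed_row nM.
  by rewrite mulmxBr mulmx1 epsM detS1 scale1r subrr.
have S1 : S = 1%:M; last first.
  exists 1%:M, 1%:M; rewrite S1 mulmx1; split=> //; exists 1%N; rewrite expr1; exact: subrr.
have [n2|n3] : (n <= 2)%N \/ (2 < n)%N by case: ltnP; [right|left].
  have m1 : (m <= 1)%N by rewrite -ltnS (leq_trans mn).
  move: S detS1 {detS sS}; case: (m) m1 => [|[|]] // _ S detS1.
    by apply/matrixP; case.
  by rewrite [S]mx11_scalar; congr _%:M; rewrite -detS1 det_mx11.
have [w wA nw] := wP n3.
case/is_scalar_mxP: sS => lam Sl.
have E := schur_scalar _ _ _ _ _ _ dA piv _ _ _ HKv _ _ wA Sl.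
(* A scalar complement would put w in the span of v and w A. *)
have [l0|l0] := eqVneq lam 0.
  have w0 : w = 0 by apply: (can_inj (mulmxK uA)); rewrite E l0 scale0r mul0mx.
  by case: (nw 0 0); rewrite !scale0r addr0.
case: (nw ((w *m phi) 0 0) lam^-1).
rewrite E scalerA mulVf // scale1r {2}[w *m phi]mx11_scalar mul_scalar_mx.
by rewrite addrC subrK.
Qed.

(** * Stable forms and their companion matrices *)

(** Over an infinite-dimensional space, [A] and [M] can be carried by the same
    operator: both are the identity plus the two products of an injective
    [P] and a surjective [Q]. The matrices [L] and [S] witness injectivity and
    surjectivity. *)
Definition stable_form (F : fieldType) r N (A : 'M[F]_r) (M : 'M[F]_N) :=
  exists (P : 'M_(N, r)) (Q L : 'M_(r, N)) (S : 'M_(N, r)),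
  [/\ L *m P = 1%:M, Q *m S = 1%:M, M = 1%:M + P *m Q & A = 1%:M + Q *m P].

Lemma ublock_mul (F : fieldType) n k (X X' : 'M[F]_n) (c c' : 'M_(n, k)) (r r' : 'M_k) :
  block_mx X c 0 r *m block_mx X' c' 0 r' = block_mx (X *m X') (X *m c' + c *m r') 0 (r *m r').
Proof. by rewrite mulmx_block !(mul0mx, mulmx0) !(addr0, add0r). Qed.

Section Products.
Variable R : pzRingType.
Implicit Types a B : R.

Lemma prod3_involution_pair (P : R -> Prop) a B : P a -> involution_pair R 1 B ->
  prod3 P (@involution R) (@involution R) (a * B).
Proof.
move=> Pa [s [t [_ _ ss tt BE]]]; exists a, s, t.
by split=> //; rewrite /involution ?expr2 // -mulrA -BE mulr1.
Qed.

Lemma prod3_graded_pair (P : R -> Prop) a B : P a -> graded_pair R 1 B ->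
  prod3 P (@unipotent2 R) (@unipotent2 R) (a * B).
Proof.
move=> Pa [X [Y [D [_ [[XX YY _] [_ _ BE]]]]]]; exists a, (1 + X), (1 + Y).
split=> //; first by rewrite /unipotent2 [1 + X]addrC addrK expr2.
  by rewrite /unipotent2 [1 + Y]addrC addrK expr2.
by rewrite -mulrA -BE mulr1.
Qed.
End Products.

Section Models.
Variables (F : fieldType) (n k : nat) (A zeta : 'M[F]_n) (g : 'M[F]_(n, k)).

Definition model (Y : 'M[F]_n) : 'M[F]_(n + n + k) :=
  block_mx (block_mx A Y 0 1%:M) (col_mx g 0) 0 1%:M.

(** What is left of [model] once an involution or a unipotent factor is divided
    out on the left. *)
Definition companion s (rho : 'M[F]_k) : 'M[F]_(n + n + k) :=
  block_mx (block_mx 0 s%:M A zeta) (col_mx 0 g) 0 rho.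

(** The involution swaps the first two blocks, and acts as [rho] on the
    last. *)
Lemma model_involution rho : rho *m rho = 1%:M ->
  exists2 a : 'M[F]_(n + n + k), involution a & model zeta = a * companion 1 rho.
Proof.
move=> rr; exists (block_mx (block_mx 0 1%:M 1%:M 0) 0 0 rho).
  rewrite /involution expr2 -mulmxE !mulmx_block !(mul0mx, mulmx0, mulmx1) !(addr0, add0r).
  by rewrite rr -!scalar_mx_block.
rewrite -mulmxE /model /companion !mulmx_block mul_block_col.
by rewrite !(mul0mx, mulmx0, mul1mx) !(addr0, add0r) rr.
Qed.

(** The unipotent subtracts the first block row from the second. A further
    conjugation, by the addition of the first two blocks, clears the upper left
    corner; this is what dictates the value [zeta - 1 - A] of [Y]. *)
Lemma model_unipotent :
  exists a S R : 'M[F]_(n + n + k), [/\ unipotent2 a, R *m S = 1%:M, S *m R = 1%:M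
   & model (zeta - 1%:M - A) = a * (S *m companion (-1) 1%:M *m R)].
Proof.
exists (block_mx (block_mx 1%:M 0 (- 1%:M) 1%:M) 0 0 1%:M).
exists (block_mx (block_mx 1%:M 1%:M 0 1%:M) 0 0 1%:M).
exists (block_mx (block_mx 1%:M (- 1%:M) 0 1%:M) 0 0 1%:M).
split.
- rewrite /unipotent2 expr2 -[1 : 'M_(n + n + k)]/(1%:M) !scalar_mx_block.
  rewrite !opp_block_mx !add_block_mx !subrr !oppr0 !addr0.
  rewrite -mulmxE !mulmx_block !(mul0mx, mulmx0, mulmx1) !(addr0, add0r).
  by rewrite !block_mx0.
- rewrite !mulmx_block !(mul0mx, mulmx0, mulmx1, mul1mx) !(addr0, add0r).
  by rewrite subrr -!scalar_mx_block.
- rewrite !mulmx_block !(mul0mx, mulmx0, mulmx1, mul1mx) !(addr0, add0r).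
  by rewrite addNr -!scalar_mx_block.
have s1 : (-1)%:M = - 1%:M :> 'M[F]_n by rewrite -scaleN1r scale_scalar_mx mulr1.
rewrite -mulmxE /model /companion s1 !ublock_mul !mulmx_block !mul_block_col.
rewrite !(mul0mx, mulmx0, mul1mx, mulmx1, mulmxN, mulNmx) !(addr0, add0r).
rewrite !mul_block_col !(mul0mx, mul1mx, mulNmx, addr0, addNr).
congr (block_mx (block_mx _ _ _ _) _ _ _); apply/matrixP => i j; rewrite !mxE; ring.
Qed.

(** The hypothesis is the surjectivity of the block row formed by [A - 1], [Y]
    and [g]. *)
Lemma model_stable_form Y (S1 S2 : 'M[F]_n) (S3 : 'M_(k, n)) :
  (A - 1%:M) *m S1 + Y *m S2 + g *m S3 = 1%:M -> stable_form F n _ A (model Y).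
Proof.
move=> E; exists (col_mx (col_mx 1%:M 0) 0), (row_mx (row_mx (A - 1%:M) Y) g).
exists (row_mx (row_mx 1%:M 0) 0), (col_mx (col_mx S1 S2) S3); split.
- by rewrite !mul_row_col !mulmx0 mulmx1 !addr0.
- by rewrite !mul_row_col.
- rewrite /model !mul_col_row mul_col_mx !(mul1mx, mul0mx) [in RHS]scalar_mx_block.
  rewrite [X in block_mx X _ _ _ + _]scalar_mx_block !add_block_mx !(addr0, add0r).
  by congr (block_mx (block_mx _ _ _ _) _ _ _); rewrite addrC subrK.
by rewrite !mul_row_col !mulmx0 mulmx1 !addr0 addrC subrK.
Qed.
End Models.

Lemma graded_similar (F : fieldType) n m (B : 'M[F]_n) (G : 'M_m) S R :
  R *m S = 1%:M -> S *m R = 1%:M -> B *m S = S *m G ->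
  graded_pair 'M_m 1 G -> graded_pair 'M_n 1 B.
Proof. by move=> RS SR BS gG; have := graded_lift _ _ _ S R B G RS BS gG; rewrite SR. Qed.

Lemma involution_similar (F : fieldType) n m (B : 'M[F]_n) (G : 'M_m) S R :
  R *m S = 1%:M -> S *m R = 1%:M -> B *m S = S *m G ->
  involution_pair 'M_m 1 G -> involution_pair 'M_n 1 B.
Proof. by move=> RS SR BS gG; have := involution_lift _ _ _ S R B G RS BS gG; rewrite SR. Qed.

(** Types III and IUU are obtained together, from the same stable form: their
    first factor is the same involution. *)
Definition stable_III_IUU (F : fieldType) r (A : 'M[F]_r) := exists N (M : 'M[F]_N),
  [/\ stable_form F r N A M,
     prod3 (@involution 'M[F]_N) (@involution 'M[F]_N) (@involution 'M[F]_N) M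
   & prod3 (@involution 'M[F]_N) (@unipotent2 'M[F]_N) (@unipotent2 'M[F]_N) M].

Definition stable_UII (F : fieldType) r (A : 'M[F]_r) := exists N (M : 'M[F]_N),
  stable_form F r N A M /\
     prod3 (@unipotent2 'M[F]_N) (@involution 'M[F]_N) (@involution 'M[F]_N) M.

Lemma III_IUU_of_companion (F : fieldType) r n k (A0 : 'M[F]_r) (A zeta : 'M[F]_n)
    (g : 'M_(n, k)) (rho : 'M_k) :
  stable_form F r _ A0 (model F n k A g zeta) -> rho *m rho = 1%:M ->
  graded_pair _ 1 (companion F n k A zeta g 1 rho) -> stable_III_IUU F r A0.
Proof.
move=> sf rr gB; have [a ia E] := model_involution _ _ _ A zeta g rho rr.
exists _, (model F n k A g zeta); split=> //; rewrite E.
  by apply: prod3_involution_pair => //; apply: graded_involution_pair => //; rewrite mulr1.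
exact: prod3_graded_pair.
Qed.

Lemma UII_of_companion (F : fieldType) r n k (A0 : 'M[F]_r) (A zeta : 'M[F]_n)
    (g : 'M_(n, k)) :
  stable_form F r _ A0 (model F n k A g (zeta - 1%:M - A)) ->
  involution_pair _ 1 (companion F n k A zeta g (-1) 1%:M) -> stable_UII F r A0.
Proof.
move=> sf gB; have [a [S [R [ia RS SR E]]]] := model_unipotent _ _ _ A zeta g.
exists _, (model F n k A g (zeta - 1%:M - A)); split=> //; rewrite E.
apply: prod3_involution_pair => //; apply: (involution_similar _ _ _ _ _ S R RS SR _ gB).
by rewrite -mulmxA RS mulmx1.
Qed.

(** The block companion matrix of [t^2 - (M + N) t + M N] is triangularized by
    the factor [t - N], as in the scalar case; the sign [s] is absorbed in the
    first block. *)
Lemma companion_triangular (F : fieldType) n k (A M N : 'M[F]_n) (g : 'M_(n, k)) s rho :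
  s * s = 1 -> N \in unitmx -> s *: A = - (M *m N) ->
  exists S R : 'M[F]_(n + n + k), [/\ R *m S = 1%:M, S *m R = 1%:M
   & companion F n k A (M + N) g s rho *m S =
     S *m block_mx (block_mx N N 0 M) (col_mx 0 g) 0 rho].
Proof.
move=> ss uN AE.
exists (block_mx (block_mx (s *: invmx N) 0 1%:M 1%:M) 0 0 1%:M).
exists (block_mx (block_mx (s *: N) 0 (- s *: N) 1%:M) 0 0 1%:M).
have AN : A *m (s *: invmx N) = - M.
  by rewrite -scalemxAr scalemxAl AE mulNmx mulmxK.
split.
- rewrite ublock_mul !mulmx_block !(mul0mx, mulmx0, mul1mx, mulmx1) !(addr0, add0r).
  rewrite -!scalemxAr -!scalemxAl mulmxV // !scalerA mulrN ss.
  by rewrite scaleN1r addNr scale1r -!scalar_mx_block.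
- rewrite ublock_mul !mulmx_block !(mul0mx, mulmx0, mul1mx, mulmx1) !(addr0, add0r).
  rewrite -!scalemxAr -!scalemxAl mulVmx // !scalerA ss.
  by rewrite scaleNr addrN scale1r -!scalar_mx_block.
rewrite /companion !ublock_mul !mulmx_block mul_block_col.
rewrite !(mul0mx, mulmx0, mul1mx, mulmx1) !(addr0, add0r).
rewrite AN addrA addNr add0r.
rewrite -!scalemxAl mulVmx // scalemx1 [N + M]addrC.
by [].
Qed.

(** * Nonscalar matrices *)

Definition mx22 (F : fieldType) (a b c d : F) : 'M[F]_(1 + 1) :=
  block_mx a%:M b%:M c%:M d%:M.

Lemma mx22M (F : fieldType) (a b c d a' b' c' d' : F) :
  mx22 F a b c d *m mx22 F a' b' c' d' =
  mx22 F (a * a' + b * c') (a * b' + b * d') (c * a' + d * c') (c * b' + d * d').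
Proof. by rewrite /mx22 mulmx_block -!scalar_mxM -!raddfD. Qed.

Lemma mx22D (F : fieldType) (a b c d a' b' c' d' : F) :
  mx22 F a b c d + mx22 F a' b' c' d' = mx22 F (a + a') (b + b') (c + c') (d + d').
Proof. by rewrite /mx22 add_block_mx -!raddfD. Qed.

Lemma mx22N (F : fieldType) (a b c d : F) :
  - mx22 F a b c d = mx22 F (- a) (- b) (- c) (- d).
Proof. by rewrite /mx22 opp_block_mx -!raddfN. Qed.

Lemma mx22_1 (F : fieldType) : 1 = mx22 F 1 0 0 1.
Proof. by rewrite /mx22 !raddf0 -scalar_mx_block. Qed.

Lemma mx22_0 (F : fieldType) : 0 = mx22 F 0 0 0 0.
Proof. by rewrite /mx22 !raddf0 block_mx0. Qed.

(** The Jordan block of size 2 for the eigenvalue -1. A block of size 1 would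
    not do: there [(1 + X)(1 + Y)] is 1. *)
Lemma graded_jordan2 (F : fieldType) : graded_pair _ 1 (mx22 F (-1) 1 0 (-1)).
Proof.
exists (mx22 F 0 0 (-4) 0), (mx22 F (-2) 1 (-4) 2), (mx22 F (-1) 0 (-4) 1).
split; first by split; split; rewrite ?mul1r ?mulr1.
rewrite -!mulmxE !mulmx1 mx22_1 mx22_0 !mx22D !mx22M !mx22N.
do 2!split; congr mx22; ring.
Qed.

Lemma nilpotent0 (R : pzRingType) : nilpotent R 0.
Proof. by exists 1%N; rewrite expr1. Qed.

(** [N] is unipotent, and [M] is so after projection by [pi] onto the kernel of
    the row [eps]. *)
Section Triangular.
Variables (F : fieldType) (n : nat) (M N : 'M[F]_n) (eps : 'rV[F]_n) (tau : 'cV[F]_n).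
Hypothesis nN : nilpotent 'M_n (N - 1).
Hypothesis et : eps *m tau = 1%:M.
Let pi := 1%:M - tau *m eps.
Hypothesis nM : nilpotent 'M_n ((M - 1) *m pi).
Variable rho : 'M[F]_n.

Definition triangular := block_mx (block_mx N N 0 M) (col_mx 0 1%:M) 0 rho.

Lemma triangular_unipotent : nilpotent 'M_n (M - 1) -> rho = 1%:M ->
  graded_pair _ 1 triangular.
Proof.
move=> nM1 r1; have [k Tk] : nilpotent _ (triangular - 1).
  rewrite /triangular -[1 : 'M_(n + n + n)]/(1%:M) !scalar_mx_block.
  rewrite !opp_block_mx !add_block_mx !oppr0 !addr0 r1 subrr.
  apply: nilpotent_block; last exact: nilpotent0.
  exact: nilpotent_block.
by apply: (unipotent_graded _ _ _ _ k); rewrite ?mulr1 ?mul1r.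
Qed.

Hypothesis two : (2 : F) != 0.
Hypothesis eM : eps *m M = - eps.

Let epi : eps *m pi = 0.
Proof. by rewrite mulmxBr mulmx1 mulmxA et mul1mx subrr. Qed.

(** The rows [eps] of the second and third blocks span an invariant plane of
    row vectors on which the matrix acts as a Jordan block for -1; the
    reflection [rho] provides the second of them. The matrix is unipotent on
    their common kernel. *)
Lemma triangular_jordan2 : rho = 1%:M - 2 *: (tau *m eps) -> graded_pair _ 1 triangular.
Proof.
move=> rhoE; have er : eps *m rho = - eps.
  rewrite rhoE mulmxBr mulmx1 -scalemxAr mulmxA et mul1mx.
  by apply/rowP => i; rewrite !mxE; ring.
pose R := col_mx (row_mx (row_mx (0 : 'rV_n) eps) 0) (row_mx (0 : 'rV_(n + n)) eps).
pose S := row_mx (col_mx (col_mx (0 : 'cV_n) tau) 0) (col_mx (0 : 'cV_(n + n)) tau).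
have RS : R *m S = 1%:M.
  rewrite mul_col_row !mul_row_col !(mul0mx, mulmx0) et !(addr0, add0r).
  by rewrite -scalar_mx_block.
have RB : R *m triangular = mx22 F (-1) 1 0 (-1) *m R.
  rewrite /R /triangular /mx22 mul_col_mx mul_block_col !mul_row_block.
  rewrite !mul_scalar_mx !(mul0mx, mulmx0, scale1r, scaleN1r, scale0r) !(addr0, add0r).
  rewrite ?mul_row_col !(mul0mx, mulmx0, mulmx1) !(addr0, add0r) eM er.
  by rewrite !opp_row_mx !oppr0 add_row_mx addr0 add0r.
have PiE : 1%:M - S *m R = block_mx (block_mx 1%:M 0 0 pi) 0 0 pi.
  rewrite /S /R mul_row_col !mul_col_row !scalar_mx_block.
  rewrite !(mul0mx, mulmx0) !add_block_mx !opp_block_mx !add_block_mx.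
  by rewrite !(addr0, add0r, oppr0) opp_block_mx add_block_mx !(addr0, oppr0).
have uJ : mx22 F (-1) 1 0 (-1) - 1 \in unitmx.
  rewrite mx22_1 mx22N mx22D /mx22 unitmxE [(0 - 0)%:M](_ : _ = 0); last first.
    by rewrite subrr raddf0.
  by rewrite det_ublock !det_scalar1 unitfE mulf_neq0 // -opprD oppr_eq0.
have nPi : nilpotent _ ((triangular - 1) *m (1%:M - S *m R)).
  rewrite PiE /triangular -[1 : 'M_(n + n + n)]/(1%:M) !scalar_mx_block.
  rewrite !opp_block_mx !add_block_mx !oppr0 !addr0 ublock_mul.
  have -> : (rho - 1%:M) *m pi = 0.
    rewrite mulmxBl mul1mx rhoE mulmxBl mul1mx -scalemxAl -mulmxA epi mulmx0.
    by rewrite scaler0 subr0 subrr.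
  apply: nilpotent_block; last exact: nilpotent0.
  by rewrite ublock_mul mulmx1; apply: nilpotent_block.
have [f [ff gf _ gf']] := split_nilpotent _ _ _ _ _ _ _ RB RS uJ nPi.
rewrite -[1](subrK f); apply: graded_pair_add => //.
- by rewrite mulrBl !mulrBr ff !mulr1 !mul1r subrr subr0.
- by rewrite mulrBl mul1r ff subrr.
- by rewrite mulrBr mulr1 ff subrr.
by apply: gf; exact: graded_jordan2.
Qed.

(** Here the eigenvalue -1 is carried by one row vector only, and splits off as
    the product of the involutions -1 and 1. *)
Lemma triangular_involutions : rho = 1%:M -> involution_pair _ 1 triangular.
Proof.
move=> rhoE.
(* The coefficient c of the last block solves 1 + c = - c, so that R spans an
   invariant line. *)
pose R := row_mx (row_mx (0 : 'rV_n) eps) (- 2^-1 *: eps).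
pose S := col_mx (col_mx (0 : 'cV_n) tau) (0 : 'cV_n).
have RS : R *m S = 1%:M.
  by rewrite !mul_row_col !(mul0mx, mulmx0) et !(addr0, add0r).
have RB : R *m triangular = (- 1%:M) *m R.
  rewrite /R /triangular !mul_row_block !mul_row_col rhoE.
  rewrite !(mul0mx, mulmx0, mulmx1, mul1mx, mulNmx) !(addr0, add0r) eM.
  rewrite !opp_row_mx oppr0; congr row_mx.
  apply/rowP => i; rewrite !mxE; field.
  by [].
have PiE : 1%:M - S *m R = block_mx (block_mx 1%:M 0 0 pi)
    (col_mx 0 (2^-1 *: (tau *m eps))) 0 1%:M.
  rewrite /S /R !mul_col_row !mul_col_mx !(mul0mx, mulmx0) !scalar_mx_block.
  rewrite !opp_block_mx !add_block_mx !(addr0, add0r, oppr0).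
  congr (block_mx _ _ _ _).
  rewrite opp_col_mx oppr0; congr col_mx.
  by rewrite -scalemxAr scaleNr opprK.
have uJ : - 1%:M - 1 \in @unitmx F 1.
  by rewrite unitmxE det_mx11 !mxE unitfE -opprD oppr_eq0.
have nPi : nilpotent _ ((triangular - 1) *m (1%:M - S *m R)).
  rewrite PiE /triangular -[1 : 'M_(n + n + n)]/(1%:M) !scalar_mx_block.
  rewrite !opp_block_mx !add_block_mx !oppr0 !addr0 ublock_mul rhoE subrr mul0mx.
  apply: nilpotent_block; last exact: nilpotent0.
  by rewrite ublock_mul mulmx1; apply: nilpotent_block.
have [f [ff _ gf gf']] := split_nilpotent _ _ _ _ _ _ _ RB RS uJ nPi.
have ee : (1 - f) * (1 - f) = 1 - f by rewrite mulrBl !mulrBr ff !mulr1 !mul1r subrr subr0.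
rewrite -[1](subrK f); apply: involution_pair_add.
- by rewrite mulrBl mul1r ff subrr.
- by rewrite mulrBr mulr1 ff subrr.
- exact: graded_involution_pair.
apply: gf; exists (- 1), 1; split; rewrite ?mulrNN ?mulr1 //.
- by split; rewrite ?mulr1 ?mul1r.
- by split; rewrite ?mulr1 ?mul1r.
Qed.
End Triangular.

Section Nonscalar.
Variables (F : fieldType) (r : nat) (A : 'M[F]_r).
Hypothesis uA : A \in unitmx.
Hypothesis nA : ~~ is_scalar_mx A.
Hypothesis dA : \det A = 1 \/ \det A = -1.

(** The exceptional eigenvalue of [M] is [det (- s A)], which is 1 or -1. When
    it is 1, in particular in characteristic 2, [M] is unipotent. *)
Lemma signed_factorization s : s * s = 1 -> exists (M N : 'M[F]_r) (eps : 'rV_r) (tau : 'cV_r),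
  [/\ s *: A = - (M *m N), N \in unitmx, nilpotent 'M_r (N - 1), eps *m tau = 1%:M
    & nilpotent 'M_r ((M - 1) *m (1%:M - tau *m eps))] /\
  (nilpotent 'M_r (M - 1) \/ (2 : F) != 0 /\ eps *m M = - eps).
Proof.
move=> ss; have s2 : s = 1 \/ s = -1.
  have /eqP : (s - 1) * (s + 1) = 0 by rewrite -subr_sqr expr1n expr2 ss subrr.
  by rewrite mulf_eq0 subr_eq0 addr_eq0 => /orP[]/eqP; [left|right].
have s0 : - s != 0.
  by rewrite oppr_eq0; apply/eqP => s0; move/eqP: ss; rewrite s0 mulr0 eq_sym oner_eq0.
have dB : \det (- s *: A) = 1 \/ \det (- s *: A) = -1.
  rewrite detZ; case: s2 dA => -> [] ->; rewrite ?opprK ?expr1n ?mul1r ?mulr1; auto.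
    by rewrite -signr_odd; case: odd; rewrite ?expr1 ?expr0; auto.
  by rewrite -signr_odd mulrN1; case: odd; rewrite ?expr1 ?expr0 ?opprK; auto.
have uB : - s *: A \in unitmx.
  by rewrite unitmxE unitfE; case: dB => ->; rewrite ?oppr_eq0 oner_eq0.
have nB : ~~ is_scalar_mx (- s *: A).
  apply: contra nA => /is_scalar_mxP[a E]; apply/is_scalar_mxP; exists ((- s)^-1 * a).
  by rewrite -scale_scalar_mx -E scalerA mulVf // scale1r.
have [M [N [eps [tau [E nN nM eM et]]]]] := unipotent_factorization _ _ _ uB nB.
exists M, N, eps, tau; split; first split=> //.
- by rewrite -E scaleNr opprK.
- by move: uB; rewrite E unitmx_mul => /andP[].
have dM1 : \det (- s *: A) = 1 -> nilpotent 'M_r (M - 1).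
  move=> d1; apply: nilpotent_of_fixed_row nM.
  by rewrite mulmxBr mulmx1 eM d1 scale1r subrr.
case: dB => [/dM1|d1]; first by left.
have [two|two] := eqVneq (2 : F) 0; last by right; rewrite eM d1 scaleN1r.
left; apply: dM1; rewrite d1; apply/eqP; rewrite -subr_eq0 -opprD oppr_eq0.
by apply/eqP; exact: two.
Qed.

Lemma nonscalar_III_IUU : stable_III_IUU F r A.
Proof.
have [M [N [eps [tau [[AE uN nN et nM] cM]]]]] := signed_factorization 1 (mulr1 1).
have sf : stable_form F r _ A (model F r r A 1%:M (M + N)).
  by apply: (model_stable_form _ _ _ _ _ _ 0 0 1%:M); rewrite !mulmx0 !add0r mulmx1.
have key rho : rho *m rho = 1%:M -> graded_pair _ 1 (triangular F r M N rho) ->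
    stable_III_IUU F r A.
  move=> rr gT; apply: III_IUU_of_companion sf rr _.
  have [S [R [RS SR E]]] :=
    companion_triangular _ _ _ A M N 1%:M 1 rho (mulr1 1) uN AE.
  exact: graded_similar RS SR E gT.
case: cM => [nM1|[two eM]].
  by apply: (key 1%:M); rewrite ?mulmx1 //; apply: triangular_unipotent.
apply: (key (1%:M - 2 *: (tau *m eps))); last first.
  exact: (triangular_jordan2 _ _ _ _ _ _ nN et nM _ two eM (erefl _)).
rewrite mulmxBl mul1mx -scalemxAl mulmxBr mulmx1 -scalemxAr.
have -> : tau *m eps *m (tau *m eps) = tau *m eps.
  by rewrite mulmxA -[tau *m eps *m tau]mulmxA et mulmx1.
by apply/matrixP => i j; rewrite !mxE; ring.
Qed.

Lemma nonscalar_UII : stable_UII F r A.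
Proof.
have N1 : (-1) * (-1) = 1 :> F by rewrite mulrNN mulr1.
have [M [N [eps [tau [[AE uN nN et nM] cM]]]]] := signed_factorization (-1) N1.
have sf : stable_form F r _ A (model F r r A 1%:M (M + N - 1%:M - A)).
  by apply: (model_stable_form _ _ _ _ _ _ 0 0 1%:M); rewrite !mulmx0 !add0r mulmx1.
apply: UII_of_companion sf _.
have [S [R [RS SR E]]] :=
  companion_triangular _ _ _ A M N 1%:M (-1) 1%:M N1 uN AE.
apply: involution_similar RS SR E _.
case: cM => [nM1|[two eM]].
  by apply: graded_involution_pair; [rewrite mulr1 | exact: triangular_unipotent].
exact: (triangular_involutions _ _ _ _ _ _ nN et nM _ two eM (erefl _)).
Qed.
End Nonscalar.

(** * Scalar matrices *)

Lemma companion_0 (F : fieldType) n (A zeta : 'M[F]_n) (g : 'M_(n, 0)) s rho :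
  exists S R, [/\ R *m S = 1%:M, S *m R = 1%:M
   & companion F n 0 A zeta g s rho *m S = S *m block_mx 0 s%:M A zeta].
Proof.
exists (col_mx 1%:M 0), (row_mx 1%:M 0); split.
- by rewrite mul_row_col mulmx1 mul0mx addr0.
- rewrite mul_col_row !(mul1mx, mul0mx, mulmx0) [in RHS]scalar_mx_block.
  by congr block_mx; apply/matrixP => -[].
rewrite /companion mul_block_col [RHS]mul_col_mx !(mul1mx, mul0mx, mulmx1, mulmx0) !addr0.
by [].
Qed.

(** The columns of the change of basis are [W] and [B W], where [B] is the
    matrix on the left and [W] has blocks [s C] and 1. The value of [zeta] makes
    the second block of [B W] equal to [C^-1 + D], and the twisted commutation
    of [C] and [D] expresses [B (B W)] through [W] and [B W]. *)
Lemma twisted_similar (F : fieldType) n (A C Ci D Di h : 'M[F]_n) (s : F) :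
  s * s = 1 -> Ci *m C = 1%:M -> C *m Ci = 1%:M -> Di *m D = 1%:M ->
  D *m C *m h = (- s *: A) *m C *m D ->
  exists S R, [/\ R *m S = 1%:M, S *m R = 1%:M
   & block_mx 0 s%:M A (- s *: A *m C + Ci + D) *m S =
     S *m block_mx 0 (- h) 1%:M (Ci + D + C *m h)].
Proof.
move=> ss CiC CCi DiD tw.
exists (block_mx (s *: C) s%:M 1%:M (Ci + D)).
exists (block_mx (s *: Ci + s *: (Ci *m Di *m Ci)) (- (Ci *m Di)) (- s *: (Di *m Ci)) Di).
have RS : block_mx (s *: Ci + s *: (Ci *m Di *m Ci)) (- (Ci *m Di)) (- s *: (Di *m Ci)) Di
   *m block_mx (s *: C) s%:M 1%:M (Ci + D) = 1%:M.
  have e1 : Ci *m Di *m Ci *m C = Ci *m Di by rewrite -mulmxA CiC mulmx1.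
  have e2 : Ci *m Di *m D = Ci by rewrite -mulmxA DiD mulmx1.
  have e3 : Di *m Ci *m C = Di by rewrite -mulmxA CiC mulmx1.
  rewrite mulmx_block !mulmx1 !mul_mx_scalar scalar_mx_block !mulmxDl !mulmxDr.
  rewrite -!scalemxAl -!scalemxAr !scalerDr !scalerA mulrN mulNr ss !mulNmx.
  rewrite e1 e2 e3 CiC DiD !scaleN1r !scale1r.
  by congr block_mx; apply/matrixP => i j; rewrite !mxE; ring.
split=> //; first exact: mulmx1C.
rewrite !mulmx_block !(mulmx1, mul0mx, mulmx0, add0r, mul1mx) !mul_scalar_mx !mul_mx_scalar.
congr block_mx.
- by rewrite mulmxN -scalemxAl scalerDr; apply/matrixP => i j; rewrite !mxE; ring.
- rewrite -scalemxAr -!scalemxAl; apply/matrixP => i j; rewrite !mxE; ring.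
have e4 : - s *: A *m C *m Ci = - s *: A by rewrite -mulmxA CCi mulmx1.
have XU : (- s *: A *m C) *m (Ci + D) = - s *: A + D *m C *m h.
  by rewrite mulmxDr e4 tw.
have UC : (Ci + D) *m (C *m h) = h + D *m C *m h.
  by rewrite mulmxDl !mulmxA CiC mul1mx.
rewrite -[_ + Ci + D]addrA mulmxDl XU [in RHS]mulmxDr UC.
apply/matrixP => i j; move: (_ *m _) (_ *m _) => X Y; rewrite !mxE; ring.
Qed.

(** For [h = 1], what [twisted_similar] leaves is a graded pair without any
    condition on [xi]. *)
Lemma graded_block (F : fieldType) n (xi : 'M[F]_n) :
  graded_pair _ 1 (block_mx 0 (- 1%:M) 1%:M xi).
Proof.
exists (block_mx (- 1%:M) (- 1%:M) 1%:M 1%:M), (block_mx 0 (xi - 2%:M) 0 0),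
  (block_mx 1%:M 2%:M 0 (- 1%:M)).
split; first by split; split; rewrite ?mul1r ?mulr1.
rewrite -!mulmxE !mulmx1 -[1 : 'M_(n + n)]/(1%:M) !scalar_mx_block.
rewrite !mulmx_block !opp_block_mx !add_block_mx !mulmx_block.
rewrite -[0 : 'M_(n + n)]block_mx0.
have two : 2%:M = 1%:M + 1%:M :> 'M[F]_n by rewrite -raddfD.
rewrite !two.
rewrite !(mulmxDl, mulmxDr, mulNmx, mulmxN, mul1mx, mulmx1, mul0mx, mulmx0).
by do 2!split; congr block_mx; apply/matrixP => i j; rewrite !mxE; ring.
Qed.

(** Multiplying by the antidiagonal involution with entries [h] gives a block
    triangular matrix with diagonal blocks 1 and -1. *)
Lemma involution_block (F : fieldType) n (h xi : 'M[F]_n) :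
  h *m h = 1%:M -> h *m xi = xi ->
  involution_pair _ 1 (block_mx 0 (- h) 1%:M xi).
Proof.
move=> hh hxi; exists (block_mx 0 h h 0), (block_mx h xi 0 (- 1%:M)).
have c X : in_corner 'M_(n + n) 1 X by split; rewrite ?mul1r ?mulr1.
split; [exact: c | exact: c | | |]; rewrite -!mulmxE ?mulmx1 ?mulmx_block.
- by rewrite !(mul0mx, mulmx0) hh !(addr0, add0r) -scalar_mx_block.
- rewrite !(mulNmx, mulmxN, mul1mx, mulmx1, mul0mx, mulmx0) hh hxi !(addr0, add0r) opprK subrr.
  by rewrite oppr0 -scalar_mx_block.
by rewrite !(mulmxN, mulmx1, mul0mx, mulmx0, oppr0) hh hxi !(addr0, add0r).
Qed.

Section WeightedCycle.
Variables (F : fieldType) (k : nat).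

(** The companion matrix of [t^(k + 1) - s], seen as the weighted cycle
    [e_0 -> e_1 -> ... -> e_k -> s e_0]. *)
Definition wcycle (s : F) : 'M[F]_k.+1 := \matrix_(i, j)
  (if i == j.+1 :> nat then 1 else if (i == 0 :> nat) && (j == k :> nat) then s else 0).

Lemma wcycle_delta s (i : 'I_k.+1) : (i < k)%N ->
  wcycle s *m delta_mx i 0 = delta_mx (inord i.+1) 0 :> 'cV_k.+1.
Proof.
move=> ik; rewrite -colE; apply/matrixP => a b; rewrite !mxE ord1 andbT.
rewrite (_ : (a == inord i.+1) = (a == i.+1 :> nat)); last first.
  by rewrite -val_eqE /= inordK.
case: eqP => // _; case: eqP => //= _; by rewrite ltn_eqF.
Qed.

Lemma wcycle_delta_max s :
  wcycle s *m delta_mx ord_max 0 = s *: delta_mx ord0 0 :> 'cV_k.+1.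
Proof.
rewrite -colE; apply/matrixP => a b; rewrite !mxE ord1 andbT eqxx andbT -val_eqE /=.
by rewrite ltn_eqF ?ltn_ord //; case: eqP; rewrite ?mulr1 ?mulr0.
Qed.

Lemma wcycle_exp_delta s j : (j <= k)%N ->
  wcycle s ^+ j *m delta_mx ord0 0 = delta_mx (inord j) 0 :> 'cV_k.+1.
Proof.
elim: j => [|j IH] jk.
  by rewrite expr0 mul1mx; congr delta_mx; apply: val_inj; rewrite /= inordK.
rewrite exprS -mulmxE -mulmxA IH ?(ltnW jk) // wcycle_delta inordK //.
  by rewrite ltnS ltnW.
by rewrite ltnS ltnW.
Qed.

Lemma wcycle_exp s : wcycle s ^+ k.+1 = s%:M.
Proof.
have E0 : wcycle s ^+ k.+1 *m delta_mx ord0 0 = s *: delta_mx ord0 0 :> 'cV_k.+1.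
  rewrite exprS -mulmxE -mulmxA wcycle_exp_delta // -wcycle_delta_max.
  by congr (_ *m delta_mx _ _); apply: val_inj; rewrite /= inordK.
apply/matrixP => i j.
suff E : wcycle s ^+ k.+1 *m delta_mx j 0 = s *: delta_mx j 0 :> 'cV_k.+1.
  move/matrixP/(_ i 0): E; rewrite -colE !mxE eqxx andbT => ->.
  by case: eqP; rewrite ?mulr1 ?mulr0.
have -> : delta_mx j 0 = wcycle s ^+ j *m delta_mx ord0 0 :> 'cV_k.+1.
  have jk : (j <= k)%N by rewrite -ltnS.
  by rewrite (wcycle_exp_delta _ _ jk) inord_val.
have cE : wcycle s ^+ k.+1 *m wcycle s ^+ j = wcycle s ^+ j *m wcycle s ^+ k.+1.
  by rewrite mulmxE -!exprD addnC.
by rewrite mulmxA cE -mulmxA E0 -scalemxAr.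
Qed.

Lemma wcycle_unit s : s != 0 -> wcycle s \in unitmx.
Proof.
move=> s0; have /mulmx1_unit[]// : wcycle s *m (s^-1 *: wcycle s ^+ k) = 1%:M.
by rewrite -scalemxAr mulmxE -exprS wcycle_exp scale_scalar_mx mulVf.
Qed.

(** [E^2 - 1] divides the scalar [E^(2 (k + 1)) - 1 = s^2 - 1]. *)
Lemma wcycle_sub_inv_unit s : s != 0 -> s ^+ 2 != 1 ->
  wcycle s - invmx (wcycle s) \in unitmx.
Proof.
move=> s0 s1; have uE := wcycle_unit s s0; set E := wcycle s in uE *.
have -> : E - invmx E = invmx E *m (E ^+ 2 - 1).
  by rewrite expr2 -mulmxE mulmxBr mulmxA mulVmx // mul1mx mulmx1.
rewrite unitmx_mul unitmx_inv uE /=.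
have : (E ^+ 2 - 1) *m ((s ^+ 2 - 1)^-1 *: \sum_(i < k.+1) (E ^+ 2) ^+ i) = 1%:M.
  rewrite -scalemxAr mulmxE -subrX1 -exprM mulnC exprM wcycle_exp.
  have -> : s%:M ^+ 2 = (s ^+ 2)%:M :> 'M[F]_k.+1 by rewrite !expr2 -mulmxE -scalar_mxM.
  by rewrite -[1 : 'M_k.+1]/(1%:M) -raddfB scale_scalar_mx mulVf // subr_eq0.
by case/mulmx1_unit.
Qed.

Definition wdiag (d : F) : 'M[F]_k.+1 := diag_mx (\row_i d ^+ i).

Definition wtwist (d : F) : 'M[F]_k.+1 :=
  diag_mx (\row_i (if i == 0 :> nat then d ^- k else d)).

(** Conjugating the cycle by a geometric diagonal multiplies each arrow by [d],
    except the one that closes the cycle, on which the powers of [d] do not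
    match. *)
Lemma wdiag_wcycle s d : d != 0 -> wdiag d *m wcycle s = wtwist d *m wcycle s *m wdiag d.
Proof.
move=> d0; rewrite /wdiag /wtwist mul_diag_mx mul_mx_diag mul_diag_mx.
apply/matrixP => i j; rewrite !mxE; case: (i =P j.+1 :> nat) => [->|_].
  by rewrite !mulr1 /= exprS.
case: (i =P 0 :> nat) => [->|_]; last by rewrite !mulr0 mul0r.
case: (j =P k :> nat) => [->|_]; last by rewrite !mulr0 mul0r.
by rewrite expr0 mul1r mulrAC mulVf ?mul1r // expf_neq0.
Qed.

Lemma wdiag_unit d : d != 0 -> wdiag d \in unitmx.
Proof.
move=> d0; rewrite unitmxE det_diag unitfE; apply/prodf_neq0 => i _.
by rewrite mxE expf_neq0.
Qed.
End WeightedCycle.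

(** The case [h = 1] of the twisted similarity. *)
Lemma graded_twisted (F : fieldType) n (A C D : 'M[F]_n) (g : 'M_(n, 0)) (s : F) rho :
  s * s = 1 -> C \in unitmx -> D \in unitmx ->
  D *m C = (- s *: A) *m C *m D ->
  graded_pair _ 1 (companion F n 0 A (- s *: A *m C + invmx C + D) g s rho).
Proof.
move=> ss uC uD tw.
have [S [R [RS SR E]]] := companion_0 _ _ A (- s *: A *m C + invmx C + D) g s rho.
apply: graded_similar RS SR E _.
have tw' : D *m C *m 1%:M = (- s *: A) *m C *m D by rewrite mulmx1.
have [S' [R' [RS' SR' E']]] := twisted_similar _ _ _ _ _ _ _ _ _ ss (mulVmx uC) (mulmxV uC)
  (mulVmx uD) tw'.
by apply: graded_similar RS' SR' E' _; exact: graded_block.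
Qed.

(** The block [A - 1] makes the block row surjective by itself. *)
Lemma scalar_stable_form (F : fieldType) n (lam : F) (Y : 'M[F]_n) : lam != 1 ->
  stable_form F n _ lam%:M (model F n 0 lam%:M 0 Y).
Proof.
move=> l1; apply: (model_stable_form _ _ _ _ _ _ (lam - 1)^-1%:M 0 0).
rewrite !mulmx0 !addr0 -raddfB -scalar_mxM mulfV // subr_eq0 //.
Qed.

Section Scalar.
Variables (F : fieldType) (k : nat) (lam : F).
Hypothesis l0 : lam != 0.
Hypothesis l1 : lam != 1.
Hypothesis l2 : lam ^+ 2 != 1.

(** Comparing determinants in [D C h = lam C D] shows that [h] must have
    determinant [d = lam^(k + 1)]. This sign is put on the last basis vector;
    [involution_block] then requires the last row of [xi] to vanish when
    [d = -1]. *)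
Lemma scalar_UII : lam ^+ k.+1 * lam ^+ k.+1 = 1 -> stable_UII F k.+1 lam%:M.
Proof.
set d := lam ^+ k.+1 => dd.
pose E := wcycle F k lam; pose Ei := invmx E.
have uE : E \in unitmx by exact: wcycle_unit.
pose h : 'M[F]_k.+1 := diag_mx (\row_i (if i == k :> nat then d else 1)).
(* Normalized so that its last entry is 1: the last row of xi is then (d + 1)
   times that of Ei, which vanishes when d = -1. *)
pose D0 : 'M[F]_k.+1 := lam ^- k *: wdiag F k lam.
pose D := D0 *m (Ei - E).
have hh : h *m h = 1%:M.
  rewrite mulmx_diag -diag_const_mx; congr diag_mx; apply/rowP => i; rewrite !mxE.
  by case: ifP; rewrite ?mulr1.
have uD : D \in unitmx.
  have uf : E - Ei \in unitmx by exact: wcycle_sub_inv_unit.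
  rewrite unitmx_mul -[Ei - E]opprB -scaleN1r [X in _ && X]unitmxZ ?unitrN1 // uf andbT.
  by rewrite unitmxZ ?wdiag_unit // unitfE invr_eq0 expf_neq0.
have twE : wtwist F k lam *m E = lam *: (E *m h).
  rewrite /wtwist /E mul_diag_mx mul_mx_diag; apply/matrixP => i j; rewrite !mxE.
  case: (i =P j.+1 :> nat) => [ij|_].
    have jk : (j < k)%N by rewrite -ltnS -ij ltn_ord.
    by rewrite ?ij /= (ltn_eqF jk) !mulr1.
  case: (i =P 0 :> nat) => [_|_]; last by rewrite !(mulr0, mul0r).
  case: (j =P k :> nat) => [_|_]; last by rewrite !(mulr0, mul0r).
  rewrite /= [RHS]mulrCA mulrC; congr (_ * _); apply: (mulfI (expf_neq0 k l0)).
  by rewrite mulfV ?expf_neq0 // mulrA -exprSr dd.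
have EE : (Ei - E) *m E = E *m (Ei - E) by rewrite mulmxBl mulmxBr mulVmx // mulmxV.
have CCi : E *m h *m (h *m Ei) = 1%:M.
  by rewrite mulmxA -[E *m h *m h]mulmxA hh mulmx1 mulmxV.
have CiC := mulmx1C CCi.
have tw : D *m (E *m h) *m h = (- (-1) *: lam%:M) *m (E *m h) *m D.
  rewrite !mulmxA -[_ *m h *m h]mulmxA hh mulmx1 /D -[D0 *m _ *m E]mulmxA EE mulmxA.
  congr (_ *m _); rewrite opprK scale1r mul_scalar_mx -[lam *: E *m h]scalemxAl -twE.
  by rewrite /D0 -scalemxAl -scalemxAr wdiag_wcycle.
have hD : (h - 1%:M) *m D0 = h - 1%:M.
  rewrite /D0 -scalemxAr mulmxBl mul1mx /h /wdiag mulmx_diag -diag_const_mx.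
  apply/matrixP => i j; rewrite !mxE; case: (i =P j) => [_|_]; last first.
    by rewrite !mulr0n subrr mulr0.
  rewrite !mulr1n; case: (i =P k :> nat) => [->|_]; last by rewrite mul1r !subrr mulr0.
  by field; rewrite expf_neq0.
pose xi := h *m Ei + D + E *m h *m h.
have hxi : h *m xi = xi.
  have Ehh : E *m h *m h = E by rewrite -mulmxA hh mulmx1.
  have hDE : h *m D = D + (h *m (Ei - E) - (Ei - E)).
    have : (h - 1%:M) *m D = (h - 1%:M) *m (Ei - E) by rewrite mulmxA hD.
    by rewrite !mulmxBl !mul1mx => <-; rewrite addrC subrK.
  rewrite /xi Ehh !mulmxDr mulmxA hh mul1mx hDE mulmxBr.
  by apply/matrixP => i j; rewrite !mxE; ring.
apply: (UII_of_companion _ _ _ 0 _ lam%:M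
  (- (-1) *: lam%:M *m (E *m h) + h *m Ei + D) 0 (scalar_stable_form _ _ _ _ l1)).
have [S [R [RS SR Eq]]] := companion_0 F k.+1 lam%:M
  (- (-1) *: lam%:M *m (E *m h) + h *m Ei + D) 0 (-1) 1%:M.
apply: involution_similar RS SR Eq _.
have N1 : (-1) * (-1) = 1 :> F by rewrite mulrNN mulr1.
have [S' [R' [RS' SR' E']]] := twisted_similar _ _ _ _ _ _ _ _ _ N1 CiC CCi
  (mulVmx uD) tw.
by apply: involution_similar RS' SR' E' _; exact: involution_block.
Qed.

(** [- lam] is a root of unity of order dividing [k + 1], so that [wdiag_wcycle]
    is a plain commutation up to the scalar [- lam]. *)
Lemma scalar_III_IUU_pos : (- lam) ^+ k.+1 = 1 -> stable_III_IUU F k.+1 lam%:M.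
Proof.
move=> m1; have m0 : - lam != 0 by rewrite oppr_eq0.
pose E := wcycle F k 1; pose D := wdiag F k (- lam).
apply: (III_IUU_of_companion _ _ _ 0 _ lam%:M (- 1 *: lam%:M *m E + invmx E + D) 0 1%:M
  (scalar_stable_form _ _ _ _ l1)); first by rewrite mulmx1.
apply: graded_twisted; rewrite ?mulr1 ?wcycle_unit ?oner_eq0 ?wdiag_unit //.
rewrite wdiag_wcycle //; congr (_ *m _ *m _).
rewrite scale_scalar_mx mulN1r -diag_const_mx /wtwist; congr diag_mx; apply/rowP => i.
rewrite !mxE; case: ifP => // _; apply: (mulfI (expf_neq0 k m0)).
by rewrite mulfV ?expf_neq0 // -exprSr.
Qed.

(** Now [det (- lam)] is -1, which rules out [D C = - lam C D]. The scalar matrix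
    is first enlarged to the diagonal matrix [A] with entries 1, lam, ..., lam, which
    restores determinant 1 for [- A]. The model of [A] is a stable form of the
    smaller matrix because the first row of [zeta] vanishes. *)
Lemma scalar_III_IUU_neg : (- lam) ^+ k.+1 = -1 -> stable_III_IUU F k.+1 lam%:M.
Proof.
move=> m1; have m0 : - lam != 0 by rewrite oppr_eq0.
pose E := wcycle F k.+1 lam; pose f := E - invmx E.
pose D := wdiag F k.+1 (- lam) *m f.
have uE : E \in unitmx by exact: wcycle_unit.
have uD : D \in unitmx by rewrite unitmx_mul wdiag_unit //; exact: wcycle_sub_inv_unit.
pose A : 'M[F]_k.+2 := - wtwist F k.+1 (- lam).
pose zeta := - 1 *: A *m E + invmx E + D.
have Ef : f *m E = E *m f by rewrite mulmxBl mulmxBr mulVmx // mulmxV.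
have tw : D *m E = (- 1 *: A) *m E *m D.
  rewrite /A scaleN1r opprK /D -mulmxA Ef !mulmxA; congr (_ *m _).
  exact: wdiag_wcycle.
have AE : A = block_mx (1%:M : 'M_1) 0 0 (lam%:M : 'M_k.+1).
  apply/matrixP => i j; rewrite /A /wtwist !mxE.
  rewrite m1 invrN1 -val_eqE /=.
  case: (splitP (m := 1) i) => i' Ei; rewrite !mxE; case: (splitP (m := 1) j) => j' Ej;
    rewrite !mxE Ei Ej -?val_eqE ?ord1 /=.
  - by rewrite mulr1n opprK mulr1n.
  - by rewrite mulr0n oppr0.
  - by rewrite mulr0n oppr0.
  by rewrite eqSS -mulNrn opprK.
(* The first row of zeta is that of - E + E^-1 + (E - E^-1). *)
have z0 : usubmx (zeta : 'M_(1 + k.+1)) = 0.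
  have row0 : row 0 (wtwist F k.+1 (- lam)) = - delta_mx 0 0.
    apply/rowP => j; rewrite !mxE m1 invrN1 eqxx /=; case: eqP => [<-|nj].
      by rewrite mulr1n eqxx.
    by rewrite mulr0n [j == 0]eq_sym; case: eqP => // _; rewrite oppr0.
  have rowD : row 0 (wdiag F k.+1 (- lam)) = delta_mx 0 0.
    apply/rowP => j; rewrite !mxE expr0 eqxx /=; case: eqP => [<-|nj].
      by [].
    by rewrite [j == 0]eq_sym; case: eqP nj.
  have r0 : row 0 zeta = 0.
    rewrite /zeta /A scaleN1r opprK !raddfD /= /D !row_mul row0 rowD.
    rewrite mulNmx -!rowE /f raddfB /=.
    by apply/rowP => j; rewrite !mxE; ring.
  clearbody zeta; apply/matrixP => i j; move/rowP/(_ j): r0; rewrite ord1 !mxE => <-.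
  by congr (zeta _ _); apply: val_inj.
pose z1 : 'M[F]_(k.+1, k.+2) := dsubmx (zeta : 'M_(1 + k.+1)).
have zE : zeta = col_mx (0 : 'M_(1, k.+2)) z1 by rewrite -z0 vsubmxK.
apply: (III_IUU_of_companion _ _ _ 0 _ A zeta 0 1%:M); last 2 first.
- by rewrite mulmx1.
- by apply: graded_twisted; rewrite ?mulr1.
pose P0 : 'M[F]_(k.+2, k.+1) := (col_mx 0 1%:M : 'M_(1 + k.+1, k.+1)).
pose L0 : 'M[F]_(k.+1, k.+2) := (row_mx 0 1%:M : 'M_(k.+1, 1 + k.+1)).
have LP : L0 *m P0 = 1%:M.
  by rewrite /L0 /P0 (@mul_row_col _ _ 1 k.+1) mul0mx add0r mulmx1.
have AP : A = 1%:M + P0 *m ((lam - 1) *: L0).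
  rewrite -scalemxAr /P0 /L0 (@mul_col_row _ 1 k.+1 _ 1 k.+1) !(mulmx0, mul0mx, mulmx1).
  rewrite (scalar_mx_block 1 k.+1) (@scale_block_mx _ 1 k.+1 1 k.+1) !scaler0.
  rewrite (@add_block_mx _ 1 k.+1 1 k.+1) !addr0 AE.
  by rewrite scalemx1 -raddfD addrC subrK.
have zP : zeta = P0 *m z1.
  by rewrite /P0 (@mul_col_mx _ 1 k.+1) mul0mx mul1mx.
exists (col_mx (col_mx P0 0) 0).
exists (row_mx (row_mx ((lam - 1) *: L0) z1) 0).
exists (row_mx (row_mx L0 0) 0), (col_mx (col_mx ((lam - 1)^-1 *: P0) 0) 0).
split.
- by rewrite !mul_row_col !mulmx0 !addr0.
- rewrite !mul_row_col !mulmx0 !addr0 -scalemxAl -scalemxAr LP scalerA.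
  by rewrite mulfV ?subr_eq0 // scale1r.
- rewrite /model {1}AP {1}zP !mul_col_row mul_col_mx !(mul0mx, mulmx0).
  rewrite [in RHS]scalar_mx_block [X in block_mx X _ _ _ + _]scalar_mx_block !add_block_mx.
  by rewrite !(addr0, add0r).
rewrite !mul_row_col !mulmx0 !addr0 -scalemxAl LP scalemx1 -raddfD.
by rewrite addrC subrK.
Qed.
End Scalar.

(** * Matrices of determinant 1 or -1 *)

(** The matrix [1 1 | 0 1] is itself unipotent of index 2, and a graded pair with
    [Y = 0]. *)
Lemma identity_case (F : fieldType) r : stable_III_IUU F r 1%:M /\ stable_UII F r 1%:M.
Proof.
pose M : 'M[F]_(r + r) := block_mx 1%:M 1%:M 0 1%:M.
have sf : stable_form F r _ 1%:M M.
  exists (col_mx 1%:M 0), (row_mx 0 1%:M), (row_mx 1%:M 0), (col_mx 0 1%:M); split.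
  - by rewrite mul_row_col mulmx1 mulmx0 addr0.
  - by rewrite mul_row_col mulmx1 mulmx0 add0r.
  - rewrite mul_col_row !(mulmx0, mul0mx, mulmx1) scalar_mx_block add_block_mx.
    by rewrite !(addr0, add0r).
  by rewrite mul_row_col mulmx0 mul0mx !addr0.
have gM : graded_pair _ 1 M.
  exists (block_mx 0 1%:M 0 0), 0, (block_mx 1%:M 0 0 (- 1%:M)).
  split; first by split; split; rewrite ?mul1r ?mulr1.
  rewrite mul0r !mulr0 mul0r oppr0 addr0 !mulr1 -!mulmxE -[1 : 'M_(r + r)]/(1%:M).
  rewrite !scalar_mx_block -[0 : 'M_(r + r)]block_mx0 !mulmx_block !opp_block_mx add_block_mx.
  rewrite !(mulNmx, mulmxN, mul1mx, mulmx1, mul0mx, mulmx0, oppr0, opprK).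
  by rewrite !(addr0, add0r, oppr0, opprK).
split; exists _, M; split=> //.
- rewrite -[M]mul1r; apply: prod3_involution_pair; first by rewrite /involution expr1n.
  by apply: graded_involution_pair => //; rewrite mulr1.
- by rewrite -[M]mul1r; apply: prod3_graded_pair => //; rewrite /involution expr1n.
exists M, 1, 1; rewrite !mulr1; split=> //; rewrite /involution ?expr1n //.
rewrite /unipotent2 expr2 -mulmxE -[1 : 'M_(r + r)]/(1%:M) /M !scalar_mx_block.
rewrite opp_block_mx add_block_mx mulmx_block !subrr oppr0 addr0.
by rewrite !(mul0mx, mulmx0, addr0) block_mx0.
Qed.

Lemma opposite_case (F : fieldType) r : (2 : F) != 0 ->
  stable_III_IUU F r (-1)%:M /\ stable_UII F r (-1)%:M.
Proof.
move=> two; have sf : stable_form F r r (-1)%:M (-1)%:M.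
  have E : (-1)%:M = 1%:M + (- 2)%:M :> 'M[F]_r.
    by rewrite -raddfD; congr _%:M; ring.
  exists 1%:M, (- 2)%:M, 1%:M, (- 2^-1)%:M; split; rewrite ?mulmx1 ?mul1mx //.
  by rewrite -scalar_mxM mulrNN mulfV.
have iM : involution ((-1)%:M : 'M[F]_r).
  by rewrite /involution expr2 -mulmxE -scalar_mxM mulrNN mulr1.
have i1 : involution (1 : 'M[F]_r) by rewrite /involution expr1n.
have u1 : unipotent2 (1 : 'M[F]_r) by rewrite /unipotent2 subrr expr0n.
split; exists r, (-1)%:M; split=> //.
- by exists (-1)%:M, 1, 1; rewrite !mulr1.
- by exists (-1)%:M, 1, 1; rewrite !mulr1.
by exists 1, (-1)%:M, 1; rewrite mulr1 mul1r.
Qed.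

Theorem stable_products (F : fieldType) r (A : 'M[F]_r) :
  \det A = 1 \/ \det A = -1 -> stable_III_IUU F r A /\ stable_UII F r A.
Proof.
move=> dA; have uA : A \in unitmx.
  by rewrite unitmxE unitfE; case: dA => ->; rewrite ?oppr_eq0 oner_eq0.
have [/is_scalar_mxP[lam AE]|nA] := boolP (is_scalar_mx A); last first.
  by split; [exact: nonscalar_III_IUU | exact: nonscalar_UII].
subst A; case: r dA uA => [|k] dA uA.
  have -> : lam%:M = 1%:M :> 'M[F]_0 by apply/matrixP; case.
  exact: identity_case.
have [->|l1] := eqVneq lam 1; first exact: identity_case.
have [lE|lN1] := eqVneq lam (-1).
  rewrite lE; apply: opposite_case; apply: contraNneq l1 => two.
  by rewrite lE -subr_eq0 -opprD oppr_eq0; apply/eqP.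
have l0 : lam != 0.
  by move: uA; rewrite unitmxE det_scalar unitfE; apply: contraNneq => ->; rewrite expr0n.
have l2 : lam ^+ 2 != 1.
  by rewrite -subr_eq0 subr_sqr_1 mulf_neq0 ?subr_eq0 // addr_eq0.
rewrite det_scalar in dA; split; last first.
  by apply: scalar_UII => //; case: dA => ->; rewrite ?mulrNN mulr1.
have : (- lam) ^+ k.+1 = 1 \/ (- lam) ^+ k.+1 = -1.
  rewrite exprNn -signr_odd; case: dA => ->; case: odd;
    rewrite ?expr0 ?expr1 ?mul1r ?mulr1 ?mulrNN ?mulr1; auto.
by case; [exact: scalar_III_IUU_pos | exact: scalar_III_IUU_neg].
Qed.

(** * Finite-rank endomorphisms of an infinite-dimensional space *)

Lemma linear_pack (F : fieldType) (U W : lmodType F) (f : U -> W) :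
  linear f -> exists g : {linear U -> W}, g =1 f.
Proof.
move=> lf; pose i := GRing.isLinear.Build F U W _ f lf.
pose g : {linear U -> W} := HB.pack f i.
by exists g.
Qed.

Section Functional.
Local Open Scope classical_set_scope.
Local Open Scope ring_scope.
Variables (F : fieldType) (V : lmodType F).

(** By Zorn's lemma, take a subspace [H] that is maximal among those avoiding
    [v]: it is a hyperplane complementary to the line of [v], and [f] is the
    coordinate along [v]. *)
Lemma functional_exists (v : V) : v != 0 -> exists f : {linear V -> F^o}, f v = 1.
Proof.
move=> v0.
pose closedS (H : set V) := forall a x y, H x -> H y -> H (a *: x + y).
pose P : set (set V) := [set H | closedS H /\ ~ H v].
have [|H [[clH Hv] maxH]] := @Zorn_bigcup V P.
  move=> C CP tot; split; last by move=> [X CX Xv]; case: (CP X CX) => _; apply.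
  move=> a x y [X CX Xx] [Y CY Yy].
  have [clX _] := CP X CX; have [clY _] := CP Y CY.
  case: (tot X Y CX CY) => XY; first by exists Y => //; apply: clY => //; exact: XY.
  by exists X => //; apply: clX => //; exact: XY.
(* Stability under combinations is also true of the empty set, so that 0 in H
   has to be derived from maximality. *)
have H0 : H 0.
  apply: contrapT => nH0; pose B : set V := [set x | H x \/ x = 0].
  case: (maxH B).
    split; first by left.
    by move=> BH; apply: nH0; apply: BH; right.
  split; last by case=> // /eqP; rewrite (negPf v0).
  have HZ a x : H x -> H (a *: x).
    move=> Hx; case: nH0; have := clH (-1) _ _ Hx Hx.
    by rewrite scaleN1r addNr.
  move=> a x y [Hx|->] [Hy|->]; rewrite ?scaler0 ?addr0 ?add0r.
  - by left; exact: clH.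
  - by left; exact: HZ.
  - by left.
  by right.
have HZ a x : H x -> H (a *: x) by move=> Hx; rewrite -[_ *: _]addr0; exact: clH.
have HD x y : H x -> H y -> H (x + y) by move=> Hx; rewrite -[x]scale1r; exact: clH.
have dec x : exists t, H (x - t *: v).
  have [Hx|nHx] := pselect (H x); first by exists 0; rewrite scale0r subr0.
  pose B : set V := [set y | exists h c, H h /\ y = h + c *: x].
  have [h [c [Hh vE]]] : B v.
    apply: contrapT => nBv; case: (maxH B).
      split; first by move=> h Hh; exists h, 0; rewrite scale0r addr0.
      by move=> BH; apply: nHx; apply: BH; exists 0, 1; rewrite scale1r add0r.
    split=> // a _ _ [h [c [Hh ->]]] [h' [c' [Hh' ->]]].
    exists (a *: h + h'), (a * c + c'); split; first exact: clH.
    by rewrite scalerDr scalerA scalerDl addrACA.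
  have c0 : c != 0 by apply/eqP => c0; apply: Hv; rewrite vE c0 scale0r addr0.
  exists c^-1; rewrite vE scalerDr scalerA mulVf // scale1r opprD addrCA subrr addr0.
  by rewrite -scalerN -[- h]scaleN1r; apply/(HZ)/(HZ).
have [t tE] := choice dec.
have uniq x a : H (x - a *: v) -> t x = a.
  move=> Ha; apply/eqP; rewrite -subr_eq0; apply/negPn/negP => n0; apply: Hv.
  have -> : v = (t x - a)^-1 *: ((x - a *: v) + (-1) *: (x - t x *: v)).
    rewrite scaleN1r opprB [X in _ *: X]addrC addrA subrK -scalerBl.
    by rewrite scalerA mulVf // scale1r.
  by apply/(HZ)/(HD) => //; exact: HZ.
have [|f fE] := @linear_pack F V F^o t.
  move=> a x y; apply: uniq.
  have -> : a *: x + y - (a * t x + t y) *: v = a *: (x - t x *: v) + (y - t y *: v).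
    by rewrite scalerBr scalerA scalerDl opprD addrACA.
  by apply: clH.
exists f; rewrite fE; apply: uniq; by rewrite scale1r subrr.
Qed.
End Functional.

(** A finite-dimensional subspace, with a basis and a projection onto it, is
    given below by a linear map [i] out of a column space and a retraction [p] of
    [i]. *)
Section Frames.
Variables (F : fieldType) (V : lmodType F).

Lemma linear_mx m n (f : {linear 'cV[F]_n -> 'cV[F]_m}) :
  exists M : 'M[F]_(m, n), forall z, f z = M *m z.
Proof.
exists (\matrix_(i, j) f (delta_mx j 0) i 0) => z.
rewrite {1}[z]matrix_sum_delta linear_sum; apply/matrixP => i j.
rewrite summxE mxE; apply: eq_bigr => k _.
by rewrite big_ord1 linearZZ !mxE mulrC (ord1 j).
Qed.

Lemma linear_delta n (f : {linear 'cV[F]_n -> V}) z :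
  f z = \sum_i z i 0 *: f (delta_mx i 0).
Proof.
rewrite {1}[z]matrix_sum_delta linear_sum; apply: eq_bigr => k _.
by rewrite big_ord1 linearZZ.
Qed.

Lemma separating_functional n (i : {linear 'cV[F]_n -> V}) (p : {linear V -> 'cV[F]_n}) y :
  cancel i p -> (forall z, y <> i z) ->
  exists f : {linear V -> F^o}, f y = 1 /\ forall z, f (i z) = 0.
Proof.
move=> ip yi; have [|f fE] := functional_exists F V (y - i (p y)).
  by rewrite subr_eq0; apply/eqP; exact: yi.
have [|g gE] := @linear_pack F V F^o (fun x => f (x - i (p x))).
  move=> a x x'; rewrite -linearP; congr (f _).
  by rewrite [p _]linearP [i _]linearP scalerBr opprD addrACA.
by exists g; rewrite gE; split=> // z; rewrite gE ip subrr linear0.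
Qed.

Lemma cons_map n (i : {linear 'cV[F]_n -> V}) y :
  exists j : {linear 'cV[F]_(n + 1) -> V},
    forall z, j z = i (usubmx z) + dsubmx z 0 0 *: y.
Proof.
apply: linear_pack => a z z'.
rewrite !linearP !mxE /= scalerDl scalerDr -scalerA addrACA.
by [].
Qed.
End Frames.

Section Factor.
Variables (F : fieldType) (V : lmodType F).

Lemma extend_section n (i : {linear 'cV[F]_n -> V}) (p : {linear V -> 'cV[F]_n}) y :
  cancel i p -> (forall z, y <> i z) ->
  exists (j : {linear 'cV[F]_(n + 1) -> V}) (q : {linear V -> 'cV[F]_(n + 1)}),
    cancel j q /\ forall z, j z = i (usubmx z) + dsubmx z 0 0 *: y.
Proof.
move=> ip yi; have [f [fy fi]] := separating_functional F V n i p y ip yi.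
have [j jE] := cons_map F V n i y.
have [|q qE] := @linear_pack F V 'cV[F]_(n + 1)
    (fun x => col_mx (p x - f x *: p y) (const_mx (f x))).
  move=> a x x'; rewrite scale_col_mx add_col_mx [p _]linearP [f _]linearP.
  congr col_mx; last by apply/matrixP => s t; rewrite !mxE.
  by rewrite scalerDl scalerBr opprD scalerA addrACA.
exists j, q; split=> // z; rewrite qE jE [p _]linearD [f _]linearD [p (_ *: _)]linearZZ.
rewrite [f (_ *: _)]linearZZ ip fi fy.
rewrite add0r [_ *: 1]mulr1 addrK -[RHS]vsubmxK; congr col_mx.
by apply/matrixP => s t; rewrite !mxE !ord1.
Qed.

(** Take [r] maximal for an injection of [F^r] into the image of [w], which
    exists as the rank is finite: the injection then fills the image. *)
Lemma finite_rank_factor (w : endo V) : finite_rank w ->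
  exists r (i : {linear 'cV[F]_r -> V}) (p : {linear V -> 'cV[F]_r})
    (v : {linear 'cV[F]_r -> V}),
  [/\ cancel i p, forall z, w (v z) = i z & forall x, w x = i (p (w x))].
Proof.
move=> [n0 [e0 we]].
pose E n := `[< exists (i : {linear 'cV[F]_n -> V}) (p : {linear V -> 'cV[F]_n})
    (v : {linear 'cV[F]_n -> V}), cancel i p /\ forall z, w (v z) = i z >].
have exE : exists n, E n.
  exists 0%N; apply/asboolP.
  have lin0 (U W : lmodType F) : exists g : {linear U -> W}, g =1 fun=> 0.
    by apply: linear_pack => a x y; rewrite scaler0 addr0.
  have [i iE] := lin0 'cV[F]_0 V; have [p pE] := lin0 V 'cV[F]_0.
  exists i, p, i; split=> [z|z]; first by apply/matrixP; case.
  by rewrite !iE linear0.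
have leE n : E n -> (n <= n0)%N.
  move=> /asboolP[i [p [v [ip vi]]]].
  have /choice[c cE] : forall j : 'I_n, exists c : 'I_n0 -> F,
      i (delta_mx j 0) = \sum_k c k *: e0 k.
    by move=> j; apply: we; exists (v (delta_mx j 0)).
  pose G : 'M[F]_(n, n0) := \matrix_(s, k) p (e0 k) s 0.
  pose C : 'M[F]_(n0, n) := \matrix_(k, j) c j k.
  have GC : G *m C = 1%:M.
    apply/matrixP => s j; have := ip (delta_mx j 0); rewrite cE linear_sum => /matrixP/(_ s 0).
    rewrite summxE !mxE andbT => <-; apply: eq_bigr => k _.
    by rewrite linearZZ !mxE mulrC.
  have := mxrankM_maxl G C; rewrite GC mxrank1 => /leq_trans; apply.
  exact: rank_leq_col.
case: (ex_maxnP exE leE) => r /asboolP[i [p [v [ip vi]]]] rmax.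
exists r, i, p, v; split=> // x; apply: contrapT => nx.
have [|j [q [jq jE]]] := extend_section _ i p (w x) ip.
  by move=> z wz; apply: nx; rewrite wz ip.
have [v' v'E] := cons_map F V r v x.
suff /rmax : E (r + 1)%N by rewrite addn1 ltnn.
apply/asboolP; exists j, q, v'; split=> // z.
by rewrite v'E jE linearD linearZZ vi.
Qed.
End Factor.

Section Realization.
Variables (F : fieldType) (V : lmodType F).
Hypothesis V_infinite : infinite_dimensional V.

Lemma outside_image n (i : {linear 'cV[F]_n -> V}) : exists x, forall z, x <> i z.
Proof.
apply: contrapT => nx; apply: V_infinite; exists n, (fun k => i (delta_mx k 0)).
move=> x _; have [z ->] : exists z, x = i z.
  apply: contrapT => nz; apply: nx; exists x => z xz; apply: nz; by exists z.
by exists (fun k => z k 0); rewrite -linear_delta.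
Qed.

Variables (r : nat) (i v : {linear 'cV[F]_r -> V}) (p Q : {linear V -> 'cV[F]_r}).
Hypothesis ip : cancel i p.
Hypothesis vQ : cancel v Q.

Lemma sum_map m n (f : {linear 'cV[F]_m -> V}) (g : {linear 'cV[F]_n -> V}) :
  exists h : {linear 'cV[F]_(m + n) -> V}, forall z, h z = f (usubmx z) + g (dsubmx z).
Proof.
apply: linear_pack => a z z'.
by rewrite !linearP scalerDr addrACA.
Qed.

(** Two solutions of [Q y = q] differ by an element of the kernel of [Q]; this
    kernel has finite codimension, hence leaves any given finite-dimensional
    subspace, and one of two solutions lies outside. *)
Lemma fresh_vector n (Y : {linear 'cV[F]_n -> V}) q :
  exists2 y, Q y = q & forall s t, y <> i s + Y t.
Proof.
have [h hE] := sum_map _ _ i Y; have [h' h'E] := sum_map _ _ h v.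
have [x xh] := outside_image _ h'.
pose k := x - v (Q x).
have Qk : Q k = 0 by rewrite linearB vQ subrr.
have kh s t : k <> i s + Y t.
  move=> kE; apply: (xh (col_mx (col_mx s t) (Q x))).
  by rewrite h'E hE !col_mxKu !col_mxKd -kE subrK.
have [[s [t E]]|n1] := pselect (exists s t, v q = i s + Y t); last first.
  exists (v q); first exact: vQ.
  by move=> s t E; apply: n1; exists s, t.
exists (v q + k); first by rewrite linearD vQ Qk addr0.
move=> s' t' E'; apply: (kh (s' - s) (t' - t)).
rewrite !linearB addrACA -opprD -E -E'.
by rewrite addrC addKr.
Qed.

(** Vectors of [V] with prescribed images under [Q] that are linearly
    independent modulo the image of [i], chosen one at a time. The retractions
    are carried along so as to stay compatible. *)
Lemma fresh_family n (Q1 : 'M[F]_(r, n)) :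
  exists (Y : {linear 'cV[F]_n -> V}) (pi : {linear V -> 'cV[F]_r})
    (py : {linear V -> 'cV[F]_n}),
  [/\ cancel i pi, cancel Y py, forall t, pi (Y t) = 0, forall z, py (i z) = 0
    & forall t, Q (Y t) = Q1 *m t].
Proof.
elim: n Q1 => [|n IH] Q1.
  have [Y YE] : exists g : {linear 'cV[F]_0 -> V}, g =1 fun=> 0.
    by apply: linear_pack => a x y; rewrite scaler0 addr0.
  have [py pyE] : exists g : {linear V -> 'cV[F]_0}, g =1 fun=> 0.
    by apply: linear_pack => a x y; rewrite scaler0 addr0.
  exists Y, p, py; split=> // t; rewrite ?YE ?linear0 //.
    by apply/matrixP; case.
  by rewrite (_ : t = 0) ?mulmx0 //; apply/matrixP; case.
move: Q1; rewrite -addn1 => Q1.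
have [Y [pi [py [ipi Ypy piY pyi QY]]]] := IH (lsubmx Q1).
have [y Qy yn] := fresh_vector _ Y (rsubmx Q1).
have [h hE] := sum_map _ _ i Y.
have [ph phE] : exists g : {linear V -> 'cV[F]_(r + n)}, g =1 fun x => col_mx (pi x) (py x).
  by apply: linear_pack => a x x'; rewrite scale_col_mx add_col_mx !linearP.
have hph : cancel h ph.
  move=> z; rewrite phE hE !linearD ipi Ypy piY pyi addr0 add0r.
  exact: vsubmxK.
have [|f [fy fh]] := separating_functional _ _ _ h ph y hph.
  by move=> z; rewrite hE; exact: yn.
have fi z : f (i z) = 0.
  by have := fh (col_mx z 0); rewrite hE col_mxKu col_mxKd linear0 addr0.
have fY t : f (Y t) = 0.
  by have := fh (col_mx 0 t); rewrite hE col_mxKu col_mxKd linear0 add0r.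
have [Y' Y'E] := cons_map _ _ _ Y y.
have [pi' pi'E] : exists g : {linear V -> 'cV[F]_r}, g =1 fun x => pi x - f x *: pi y.
  apply: linear_pack => a x x'; rewrite [pi _]linearP [f _]linearP.
  by rewrite scalerDl scalerBr opprD scalerA addrACA.
have [py' py'E] : exists g : {linear V -> 'cV[F]_(n + 1)}, g =1
    fun x => col_mx (py x - f x *: py y) (const_mx (f x)).
  apply: linear_pack => a x x'; rewrite scale_col_mx add_col_mx [py _]linearP [f _]linearP.
  congr col_mx; last by apply/matrixP => s t; rewrite !mxE.
  by rewrite scalerDl scalerBr opprD scalerA addrACA.
have fY' t : f (Y' t) = dsubmx t 0 0.
  by rewrite Y'E [f _]linearD [f (_ *: _)]linearZZ fY fy add0r [_ *: 1]mulr1.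
exists Y', pi', py'; split.
- by move=> z; rewrite pi'E ipi fi scale0r subr0.
- move=> t; rewrite py'E fY' Y'E [py _]linearD [py (_ *: _)]linearZZ Ypy addrK.
  rewrite -[RHS]vsubmxK; congr col_mx.
  by apply/matrixP => a b; rewrite !mxE !ord1.
- move=> t; rewrite pi'E fY' Y'E [pi _]linearD [pi (_ *: _)]linearZZ piY add0r.
  exact: subrr.
- move=> z; rewrite py'E fi scale0r subr0 pyi.
  by rewrite (_ : const_mx 0 = 0) ?col_mx0 //; apply/matrixP => a b; rewrite !mxE.
move=> t; rewrite Y'E [Q _]linearD [Q (_ *: _)]linearZZ QY Qy.
have -> : Q1 *m t = lsubmx Q1 *m usubmx t + rsubmx Q1 *m dsubmx t.
  by rewrite -mul_row_col hsubmxK vsubmxK.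
by rewrite [X in _ = _ + rsubmx Q1 *m X]mx11_scalar mul_mx_scalar.
Qed.

(** The copy of [F^N] must extend [i] along [P1], and [Q] must restrict to [Q1]
    on it. As [F^N] is the sum of the image of [P1] and of the kernel of [L],
    this leaves the images of that kernel to be chosen, under constraints on
    their values by [Q] only: fresh vectors do. The retraction must moreover
    satisfy [Q1 pi = Q], which is arranged by means of the section [S]. *)
Lemma realization N (P1 : 'M[F]_(N, r)) (Q1 L : 'M[F]_(r, N)) (S : 'M[F]_(N, r)) :
  L *m P1 = 1%:M -> Q1 *m S = 1%:M -> (forall z, Q (i z) = Q1 *m P1 *m z) ->
  exists (iota : {linear 'cV[F]_N -> V}) (pi : {linear V -> 'cV[F]_N}),
    cancel iota pi /\ forall x, iota (P1 *m Q1 *m pi x) = i (Q x).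
Proof.
move=> LP QS Qi; have [Y [pi [py [ipi Ypy piY pyi QY]]]] := fresh_family _ Q1.
have [iota iE] : exists g : {linear 'cV[F]_N -> V}, g =1
    fun z => i (L *m z) + Y (z - P1 *m (L *m z)).
  apply: linear_pack => a x x'.
  have -> : a *: x + x' - P1 *m (L *m (a *: x + x')) =
      a *: (x - P1 *m (L *m x)) + (x' - P1 *m (L *m x')).
    by rewrite !mulmxDr -!scalemxAr scalerBr opprD addrACA.
  rewrite [Y _]linearP mulmxDr -scalemxAr [i _]linearP scalerDr.
  by rewrite addrACA.
have iP z : iota (P1 *m z) = i z.
  by rewrite iE [L *m _]mulmxA LP mul1mx subrr linear0 addr0.
have Qiota z : Q (iota z) = Q1 *m z.
  by rewrite iE [Q _]linearD Qi QY mulmxBr !mulmxA addrC subrK.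
have [p0 p0E] : exists g : {linear V -> 'cV[F]_N}, g =1 fun x => P1 *m pi x + py x.
  apply: linear_pack => a x x'; rewrite [pi _]linearP [py _]linearP mulmxDr -scalemxAr.
  by rewrite scalerDr addrACA.
have ip0 : cancel iota p0.
  move=> z; rewrite p0E iE [pi _]linearD [py _]linearD ipi piY pyi Ypy addr0 add0r.
  by rewrite addrC subrK.
have [p1 p1E] : exists g : {linear V -> 'cV[F]_N}, g =1
    fun x => p0 x + S *m (Q x - Q1 *m p0 x).
  apply: linear_pack => a x x'; rewrite [p0 _]linearP [Q _]linearP.
  have -> : a *: Q x + Q x' - Q1 *m (a *: p0 x + p0 x') =
      a *: (Q x - Q1 *m p0 x) + (Q x' - Q1 *m p0 x').
    by rewrite mulmxDr -scalemxAr scalerBr opprD addrACA.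
  by rewrite mulmxDr -scalemxAr scalerDr addrACA.
exists iota, p1; split.
  by move=> z; rewrite p1E ip0 Qiota subrr mulmx0 addr0.
move=> x; rewrite -mulmxA iP; congr (i _).
by rewrite p1E mulmxDr !mulmxA QS mul1mx addrC subrK.
Qed.
End Realization.

(** * The factorizations of u *)

Section Reorder.
Variable R : pzRingType.
Implicit Types (x a b c : R) (P Q S : R -> Prop).

Definition invertible_class P := forall a, P a -> exists a', a * a' = 1 /\ a' * a = 1.

Definition conj_stable P :=
  forall a a' b, a * a' = 1 -> a' * a = 1 -> P b -> P (a * b * a').

Lemma involution_invertible : invertible_class (@involution R).
Proof. by move=> a; rewrite /involution expr2 => aa; exists a. Qed.

Lemma unipotent_invertible : invertible_class (@unipotent2 R).
Proof.
move=> a; rewrite /unipotent2 expr2 => aa; exists (1 - (a - 1)).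
have aE : a = 1 + (a - 1) by rewrite addrC subrK.
split; first by rewrite {1}aE mulrDl mul1r mulrBr mulr1 aa subr0 subrK.
by rewrite {2}aE mulrDr mulr1 mulrBl mul1r aa subr0 subrK.
Qed.

Lemma involution_conj : conj_stable (@involution R).
Proof.
move=> a a' b aa' a'a; rewrite /involution !expr2 => bb.
by rewrite !mulrA -[a * b * a' * a]mulrA a'a mulr1 -[a * b * b]mulrA bb mulr1.
Qed.

Lemma unipotent_conj : conj_stable (@unipotent2 R).
Proof.
move=> a a' b aa' a'a; rewrite /unipotent2 !expr2 => bb.
have -> : a * b * a' - 1 = a * (b - 1) * a' by rewrite mulrBr mulrBl mulr1 aa'.
by rewrite !mulrA -[a * (b - 1) * a' * a]mulrA a'a mulr1 -[a * _ * (b - 1)]mulrA bb mulr0 mul0r.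
Qed.

Lemma prod3_swap12 P Q S x :
  invertible_class P -> conj_stable Q -> prod3 P Q S x -> prod3 Q P S x.
Proof.
move=> cP sQ [a [b [c [Pa Qb Sc xE]]]]; have [a' [aa' a'a]] := cP a Pa.
exists (a * b * a'), a, c; split=> //; first exact: sQ.
by rewrite xE -[a * b * a' * a]mulrA a'a mulr1.
Qed.

Lemma prod3_swap23 P Q S x :
  invertible_class Q -> conj_stable S -> prod3 P Q S x -> prod3 P S Q x.
Proof.
move=> cQ sS [a [b [c [Pa Qb Sc xE]]]]; have [b' [bb' b'b]] := cQ b Qb.
exists a, (b * c * b'), b; split=> //; first exact: sS.
by rewrite xE -!mulrA b'b mulr1.
Qed.

Lemma involutionN a : @involution R a -> @involution R (- a).
Proof. by rewrite /involution sqrrN. Qed.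
End Reorder.

Section Transfer.
Variables (F : fieldType) (V : lmodType F) (n : nat).
Variables (i : {linear 'cV[F]_n -> V}) (p : {linear V -> 'cV[F]_n}).
Hypothesis ip : cancel i p.

(** [K] on the image of [i], extended by the identity on the kernel of [p]. *)
Definition transfer (K : 'M[F]_n) : endo V :=
  (1 : endo V) + ((i \o (mulmx (K - 1) \o p) : {linear V -> V}) : endo V).

Lemma transferE K x : transfer K x = x + i ((K - 1) *m p x).
Proof. by []. Qed.


Lemma transferM K L : transfer (K * L) = transfer K * transfer L.
Proof.
apply: endoP => x; rewrite /endo_fun endo_mulE !transferE.
have pE z : p (x + i z) = p x + z by rewrite [p _]linearD ip.
rewrite pE -addrA -[i _ + i _]linearD; congr (_ + i _).
have -> : K * L - 1 = (L - 1) + (K - 1) * (1 + (L - 1)).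
  by rewrite [1 + _]addrC subrK mulrBl mul1r [RHS]addrC addrA subrK.
by rewrite mulmxDl -mulmxA [(1 + _) *m _]mulmxDl mul1mx.
Qed.

Lemma transfer1 : transfer 1 = 1.
Proof.
by apply: endoP => x; rewrite /endo_fun transferE subrr mul0mx linear0 addr0.
Qed.

Lemma transfer_involution K : involution K -> involution (transfer K).
Proof. by rewrite /involution !expr2 -transferM => ->; exact: transfer1. Qed.

Lemma transfer_unipotent2 K : unipotent2 K -> unipotent2 (transfer K).
Proof.
rewrite /unipotent2 !expr2 => K2; apply: endoP => x.
rewrite /endo_fun endo_mulE /transfer [1 + _]addrC addrK /= ip mulmxA.
by rewrite -[(K - 1) *m (K - 1)]/((K - 1) * (K - 1)) K2 mul0mx linear0.
Qed.

Lemma transfer_prod3 (P Q S : 'M[F]_n -> Prop) (P' Q' S' : endo V -> Prop) K :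
  (forall B, P B -> P' (transfer B)) -> (forall B, Q B -> Q' (transfer B)) ->
  (forall B, S B -> S' (transfer B)) ->
  prod3 P Q S K -> prod3 P' Q' S' (transfer K).
Proof.
move=> PP QQ SS [a [b [c [Pa Qb Sc ->]]]].
by exists (transfer a), (transfer b), (transfer c); split; auto; rewrite !transferM.
Qed.
End Transfer.

(** The subspace in question is the image of [i], which contains that of [w]. *)
Lemma restriction_matrix (F : fieldType) (V : lmodType F) (u w : endo V) r
    (i : {linear 'cV[F]_r -> V}) (p : {linear V -> 'cV[F]_r}) (B : 'M[F]_r) :
  cancel i p -> u = 1 + w -> (forall x, w x = i (p (w x))) ->
  (forall z, p (w (i z)) = B *m z) ->
  SP_matrix u (fun j => i (delta_mx j 0)) (1 + B).
Proof.
move=> ip uE wE BE; split.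
- move=> c c0 j.
  have i0 : i (\sum_k c k *: delta_mx k 0) = 0.
    by rewrite linear_sum -[RHS]c0; apply: eq_bigr => k _; rewrite linearZ.
  have := congr1 p i0; rewrite linear0.
  rewrite ip => /matrixP/(_ j 0); rewrite summxE !mxE (bigD1 j) //= !mxE !eqxx.
  rewrite mulr1 big1 ?addr0 // => k /negPf kj.
  by rewrite !mxE eq_sym kj mulr0.
- move=> _ [x _ <-].
  rewrite uE addrC addKr wE (linear_delta _ _ _ i).
  by exists (fun k => p (w x) k 0).
move=> j; rewrite uE endo_addE endo_oneE wE BE -linearD (linear_delta _ _ _ i).
apply: eq_bigr => k _; congr (_ *: _).
rewrite !mxE (bigD1 j) //= !mxE !eqxx mulr1 big1 ?addr0.
  by rewrite andbT.
by move=> l /negPf lj; rewrite !mxE lj mulr0.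
Qed.

Lemma prod3_opp (R : pzRingType) (P Q S : R -> Prop) x :
  (forall a, S a -> S (- a)) -> prod3 P Q S x -> prod3 P Q S (- x).
Proof.
move=> SN [a [b [c [Pa Qb Sc ->]]]].
by exists a, b, (- c); split; rewrite ?mulrN //; apply: SN.
Qed.

Theorem corollary1p15 (F : fieldType) (V : lmodType F)
    (V_infinite : infinite_dimensional V)
    (u : endo V) (u_SPf : SPf u)
    (det_u : SP_det u = 1 \/ SP_det u = -1)
    (eps : F) (eps_sign : eps = -1 \/ eps = 1) :
  let Inv := @involution (endo V) in
  let Uni := @unipotent2 (endo V) in
  [/\ prod3 Inv Inv Inv (eps *: u),
      [/\ prod3 Uni Inv Inv (eps *: u),
          prod3 Inv Uni Inv (eps *: u)
        & prod3 Inv Inv Uni (eps *: u)]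
    & [/\ prod3 Inv Uni Uni (eps *: u),
          prod3 Uni Inv Uni (eps *: u)
        & prod3 Uni Uni Inv (eps *: u)]].
Proof.
move=> Inv Uni.
pose invI := @involution_invertible (endo V).
pose invU := @unipotent_invertible (endo V).
pose conjI := @involution_conj (endo V).
pose conjU := @unipotent_conj (endo V).
suff [III [IUU UII]] :
    prod3 Inv Inv Inv u /\ prod3 Inv Uni Uni u /\ prod3 Uni Inv Inv u.
  have [eIII eIUU eUII] : [/\ prod3 Inv Inv Inv (eps *: u),
      prod3 Inv Uni Uni (eps *: u) & prod3 Uni Inv Inv (eps *: u)].
    case: eps_sign => ->; last by rewrite scale1r.
    rewrite scaleN1r; split; last 1 first.
    - by apply: prod3_opp UII => a; apply: involutionN.
    - by apply: prod3_opp III => a; apply: involutionN.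
    (* The sign goes to the last factor, so the involution of IUU is moved there
       and back. *)
    apply: prod3_swap12 => //; apply: prod3_swap23 => //.
    apply: prod3_opp => [a|]; first exact: involutionN.
    by apply: prod3_swap23 => //; apply: prod3_swap12.
  have eIUI : prod3 Inv Uni Inv (eps *: u) by apply: prod3_swap12 eUII.
  have eUIU : prod3 Uni Inv Uni (eps *: u) by apply: prod3_swap12 eIUU.
  split=> //; split=> //; first exact: prod3_swap23 eIUI.
  exact: prod3_swap23 eUIU.
have [_ [w w_fin uE]] := u_SPf.
have [r [i [p [v [ip wv wE]]]]] := finite_rank_factor _ _ _ w_fin.
pose Q : {linear V -> 'cV[F]_r} := p \o w.
have vQ : cancel v Q by move=> z; rewrite /Q /= wv ip.
have [B BE] := linear_mx _ _ _ (Q \o i : {linear 'cV[F]_r -> 'cV[F]_r}).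
have detA : \det (1 + B) = 1 \/ \det (1 + B) = -1.
  have uA := restriction_matrix _ _ u w r i p B ip uE wE BE.
  by move: det_u; rewrite (SP_detE uA).
have realize N M : stable_form F r N (1 + B) M ->
    exists (i' : {linear 'cV[F]_N -> V}) (p' : {linear V -> 'cV[F]_N}),
      cancel i' p' /\ u = transfer _ _ _ i' p' M.
  case=> P1 [Q1 [L [S [LP QS ME AE]]]].
  have BPQ : B = Q1 *m P1 by apply: (addrI 1).
  have [|i' [p' [ip' iE]]] :=
      realization _ _ V_infinite _ i v p Q ip vQ _ P1 Q1 L S LP QS.
    by move=> z; rewrite -BPQ -BE.
  exists i', p'; split=> //; apply: endoP => x.
  rewrite /endo_fun transferE ME [1%:M + _]addrC addrK iE uE endo_addE /Q /= -wE.
  by [].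
have [[N1 [M1 [sM1 III IUU]]] [N2 [M2 [sM2 UII]]]] := stable_products _ _ _ detA.
have [i1 [p1 [ip1 u1]]] := realize _ _ sM1.
have [i2 [p2 [ip2 u2]]] := realize _ _ sM2.
have tI1 := transfer_involution _ _ _ i1 p1 ip1.
have tU1 := transfer_unipotent2 _ _ _ i1 p1 ip1.
have tI2 := transfer_involution _ _ _ i2 p2 ip2.
have tU2 := transfer_unipotent2 _ _ _ i2 p2 ip2.
split; first by rewrite u1; apply: transfer_prod3 III.
split; first by rewrite u1; apply: transfer_prod3 IUU.
by rewrite u2; apply: transfer_prod3 UII.
Qed.
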